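(* There exists a positive constant $l$ such that for every real $X\ge2$, $$l\,\frac{X}{\log X}\le \#\{n\le X : n \text{ is squarefree and } \varphi^*\text{-practical}\}\le F_{\varphi^*}(X),$$ where $F_{\varphi^*}(X)$ is the number of $\varphi^*$-practical positive integers $n\le X$.
   Context: $\varphi^*$ is the multiplicative function with $\varphi^*(p^k)=p^k-1$ for primes $p$ and $k\ge1$. $S_{\varphi^*}(n)=\sum_{d\mid n}\varphi^*(d)$. A positive integer $n$ is $\varphi^*$-practical if every positive integer $m\le S_{\varphi^*}(n)$ equals $\sum_{d\in\mathcal{D}}\varphi^*(d)$ for some set $\mathcal{D}$ of distinct divisors of $n$. *)

(* Defs.v *)
From Stdlib Require Import Reals.
From mathcomp Require Import all_boot.
Set Implicit Arguments. Unset Strict Implicit. Unset Printing Implicit Defensive.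

Definition phistar (n : nat) : nat :=
  \prod_(p <- primes n) (p ^ logn p n - 1).

Definition Sphistar (n : nat) : nat :=
  \sum_(d <- divisors n) phistar d.

(* n is phi*-practical: n > 0 and every 1 <= m <= S_{phi*}(n) is a sum of
   phi*(d) over a set of distinct divisors d of n (divisors n is
   duplicate-free, so sets of indices into it = sets of distinct divisors). *)
Definition phistar_practical (n : nat) : bool :=
  (0 < n) &&
  [forall m : 'I_(Sphistar n).+1,
     (m == 0 :> nat) ||
     [exists A : {set 'I_(size (divisors n))},
        \sum_(i in A) phistar (nth 0 (divisors n) i) == m]].

Definition squarefreeb (n : nat) : bool :=
  (0 < n) && [forall d : 'I_n.+1, (d * d %| n) ==> (d <= 1)].

(* floor of a real, as a nat (0 for negative reals) *)
Definition nfloor (X : R) : nat := Z.to_nat (Int_part X).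

Definition F_phistar (X : R) : nat :=
  count phistar_practical (iota 1 (nfloor X)).

Definition SF_phistar (X : R) : nat :=
  count (fun n => squarefreeb n && phistar_practical n) (iota 1 (nfloor X)).

(* Main.v *)
(** On squarefree numbers [phistar] is Euler's totient, and if [n] is squarefree
    and practical then so is [p * n] for every prime [p] not dividing [n] with
    [p <= n + 2].  Fix the primorial [t] of a large [w] and include each prime
    [p > w] independently with probability [1 / (p + 1)]; a partial product [k]
    stays alive as long as the current integer [n] is at most [t * k], and then
    [t * k] is practical.  The deviation [ln k - mu n] is a martingale, and a
    product that dies at [n] has [t * k = n], where the deviation is bounded and,
    by Mertens and the choice of [w], at most [-1].  Optional stopping therefore
    bounds the first moment of the deviation over the alive products from both
    sides; the upper bound limits the alive mass and with it the second moment.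
    Comparing the two moments gives [sum 1 / k >= c] over the [k] alive at [n]
    with [n ^ J <= k < n ^ (J + 1)].  Multiplying such [t * k] by one prime
    between [n] and [X / (t k)], of which there are at least a constant times
    [X / (t k ln X)], yields distinct practical numbers. *)

Require Import Defs.
From Stdlib Require Import Reals.
From mathcomp Require Import all_boot all_order all_algebra.
From mathcomp Require Import reals Rstruct Rstruct_topology sequences exp.
From mathcomp Require Import zify ring lra.
Set Implicit Arguments. Unset Strict Implicit. Unset Printing Implicit Defensive.
Import Order.TTheory GRing.Theory Num.Theory.

(** * Practical numbers *)

Definition subset_sum (n m : nat) : Prop :=
  exists D : pred nat, m = \sum_(d <- divisors n | D d) phistar d.

(** The invariant of the multiplicative construction. [Sphistar n = n] is Gauss's totient identity,
    carried along the induction; the value [m = 0] is represented by the empty set. *)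
Definition sf_practical (n : nat) : Prop :=
  [/\ squarefreeb n, Sphistar n = n & forall m, m <= n -> subset_sum n m].

Lemma sf_practical_gt0 n : sf_practical n -> 0 < n.
Proof. by case=> /andP[]. Qed.

Lemma sf_practicalP n : sf_practical n -> squarefreeb n && phistar_practical n.
Proof.
case=> sf eqS rep; have /andP[n0 _] := sf; rewrite sf /phistar_practical n0 /=.
apply/forallP => m; apply/orP; right; apply/existsP.
have lem : m <= n by rewrite -[X in _ <= X]eqS -ltnS.
have [D defm] := rep _ lem.
exists [set i | D (nth 0 (divisors n) (nat_of_ord i))].
apply/eqP; rewrite [RHS]defm (big_nth 0) big_mkord.
by apply: eq_bigl => i; rewrite inE.
Qed.

Lemma perm_divisors_mul p n : prime p -> 0 < n -> ~~ (p %| n) ->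
  perm_eq (divisors (p * n)) (divisors n ++ map (muln p) (divisors n)).
Proof.
move=> pp n0 pn; have p0 := prime_gt0 pp.
have inj : injective (muln p) by move=> a b /eqP; rewrite eqn_pmul2l // => /eqP.
apply: uniq_perm; first exact: divisors_uniq.
  rewrite cat_uniq divisors_uniq map_inj_uniq // divisors_uniq andbT /=.
  apply/hasPn => x /mapP[d _ ->]; apply: contra pn; rewrite /= -dvdn_divisors // => h.
  by apply: dvdn_trans h; rewrite dvdn_mulr.
move=> d; rewrite mem_cat -!dvdn_divisors ?muln_gt0 ?p0 //.
case: (boolP (p %| d)) => [/dvdnP[e ->]|pd].
  rewrite mulnC dvdn_pmul2l // (mem_map inj) -dvdn_divisors //.
  case: (e %| n); rewrite ?orbT // orbF; apply/esym/negbTE.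
  by apply: contra pn => /(dvdn_trans _) -> //; rewrite dvdn_mulr.
have cpd : coprime d p by rewrite coprime_sym prime_coprime.
rewrite Gauss_dvdr //; case: (d %| n) => //=; apply/esym/negbTE.
by apply: contra pd => /mapP[e _ ->]; rewrite dvdn_mulr.
Qed.

Lemma phistar_mul p d : prime p -> 0 < d -> ~~ (p %| d) ->
  phistar (p * d) = (p - 1) * phistar d.
Proof.
move=> pp d0 pd; have p0 := prime_gt0 pp; rewrite /phistar.
have lp : logn p d = 0 by apply/eqP; rewrite -leqn0 leqNgt logn_gt0 mem_primes pp d0.
have pq : perm_eq (primes (p * d)) (p :: primes d).
  apply: uniq_perm; rewrite /= ?primes_uniq ?mem_primes ?(negbTE pd) ?andbF //.
  by move=> q; rewrite primesM // in_cons primes_prime // inE.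
rewrite (perm_big _ pq) big_cons /= lognM // lp addn0 logn_prime // eqxx expn1.
congr (_ * _); apply: eq_big_seq => q; rewrite mem_primes => /and3P[qp _ qd].
rewrite lognM // logn_prime //; case: eqP => // eqp.
by rewrite -eqp qd in pd.
Qed.

Lemma sum_divisors_mul p n (D : pred nat) : prime p -> 0 < n -> ~~ (p %| n) ->
  \sum_(d <- divisors (p * n) | D d) phistar d =
  \sum_(d <- divisors n | D d) phistar d +
  (p - 1) * \sum_(d <- divisors n | D (p * d)) phistar d.
Proof.
move=> pp n0 pn; rewrite (perm_big _ (perm_divisors_mul pp n0 pn)) big_cat /=.
congr (_ + _); rewrite big_map big_distrr /= big_seq_cond [RHS]big_seq_cond.
apply: eq_bigr => d /andP[]; rewrite -dvdn_divisors // => dn _.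
apply: phistar_mul => //; first exact: dvdn_gt0 dn.
by apply: contra pn => /dvdn_trans ->.
Qed.

Lemma squarefree_mul p n : prime p -> ~~ (p %| n) -> squarefreeb n ->
  squarefreeb (p * n).
Proof.
move=> pp pn /andP[n0 /forallP sf].
rewrite /squarefreeb muln_gt0 prime_gt0 // n0; apply/forallP => d; apply/implyP => dd.
have pd : ~~ (p %| d).
  apply: contra pn => pd; rewrite -(dvdn_pmul2l (prime_gt0 pp)).
  by apply: dvdn_trans dd; apply: dvdn_mul.
have cop : coprime (d * d) p by rewrite coprime_sym coprimeMr prime_coprime // pd.
rewrite Gauss_dvdr // in dd.
have le : d < n.+1 by rewrite ltnS; apply: dvdn_leq => //; apply: dvdn_trans dd; rewrite dvdn_mulr.
by have := sf (Ordinal le); rewrite /= dd.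
Qed.

Lemma sf_practical1 : sf_practical 1.
Proof.
split.
- by apply/andP; split=> //; apply/forallP => d; rewrite -ltnS ltn_ord implybT.
- by rewrite /Sphistar /phistar /= big_seq1 big_nil.
case=> [|[|//]] _.
  by exists pred0; rewrite big_pred0.
by exists predT; rewrite /phistar big_seq1 big_nil.
Qed.

(* Any [m <= p * n] is [b + (p - 1) * a] with [a, b <= n], because [p - 1 <= n + 1]. *)
Lemma sf_practical_mul p n : prime p -> ~~ (p %| n) -> p <= n + 2 ->
  sf_practical n -> sf_practical (p * n).
Proof.
move=> pp pn le pn'; have [sf eqS rep] := pn'; have n0 := sf_practical_gt0 pn'.
have p1 := prime_gt1 pp.
split; first exact: squarefree_mul.
  by rewrite /Sphistar sum_divisors_mul // -/(Sphistar n) eqS; nia.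
move=> m lem.
(* Divide [m] by [p - 1]: the remainder is at most [n] because [p <= n + 2]. If the quotient exceeds
   [n], it is capped at [n], and what is left is at most [p * n - (p - 1) * n = n]. *)
have [a [b [ha hb defm]]] : exists a b, [/\ a <= n, b <= n & m = b + (p - 1) * a].
  have := divn_eq m (p - 1); have : m %% (p - 1) < p - 1 by rewrite ltn_mod; lia.
  case: (leqP (m %/ (p - 1)) n) => h hr hm.
    by exists (m %/ (p - 1)), (m %% (p - 1)); split=> //; lia.
  by exists n, (m - (p - 1) * n); split=> //; nia.
have [Da da] := rep _ ha; have [Db db] := rep _ hb.
(* The divisors that are multiples of [p] represent [(p - 1) * a], the others represent [b]. *)
exists (fun d => if p %| d then Da (d %/ p) else Db d).
rewrite sum_divisors_mul // defm; congr (_ + _ * _).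
  rewrite db big_seq_cond [RHS]big_seq_cond; apply: eq_bigl => d.
  case: (boolP (d \in _)) => //=; rewrite -dvdn_divisors // => dn.
  by rewrite ifN //; apply: contra pn => /dvdn_trans ->.
by rewrite da; apply: eq_bigl => d; rewrite dvdn_mulr // mulKn //; lia.
Qed.

Definition primorial (w : nat) : nat := \prod_(1 <= p < w.+1 | prime p) p.

Lemma primorialS w : primorial w.+1 = if prime w.+1 then w.+1 * primorial w else primorial w.
Proof. by rewrite /primorial big_mkcond big_nat_recr //= -big_mkcond; case: ifP; rewrite ?muln1 // mulnC. Qed.

Lemma primorial0 : primorial 0 = 1.
Proof. by rewrite /primorial big_geq. Qed.

Lemma primorial_gt0 w : 0 < primorial w.
Proof. by elim: w => [|w IH]; rewrite ?primorial0 // primorialS; case: ifP => // _; rewrite muln_gt0. Qed.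

Lemma prime_dvd_primorial p w : prime p -> (p %| primorial w) = (p <= w).
Proof.
move=> pp; elim: w => [|w IH]; first by rewrite primorial0 dvdn1 leqn0; case: p pp => [|[]].
rewrite primorialS leq_eqVlt ltnS; case: ifP => wp.
  by rewrite Euclid_dvdM // IH dvdn_prime2.
by rewrite IH; case: eqP => // e; rewrite -e pp in wp.
Qed.

(** Euclid's argument bounds the next prime: a prime factor of [primorial w + 1] exceeds [w], so
    [w + 1 <= primorial w + 1] and [sf_practical_mul] applies. *)
Lemma sf_practical_primorial w : sf_practical (primorial w).
Proof.
elim: w => [|w IH]; first by rewrite primorial0; exact: sf_practical1.
rewrite primorialS; case: ifP => // wp; apply: sf_practical_mul => //.
  by rewrite prime_dvd_primorial // ltnn.
have P0 := primorial_gt0 w.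
have qp : prime (pdiv (primorial w + 1)) by apply: pdiv_prime; lia.
have := pdiv_dvd (primorial w + 1); have := pdiv_leq (n := primorial w + 1).
move=> /(_ ltac:(lia)) h1 h2.
have : ~~ (pdiv (primorial w + 1) <= w).
  rewrite -prime_dvd_primorial //; apply/negP => h3; move: h2.
  by rewrite dvdn_addr // dvdn1 => /eqP h; rewrite h in qp.
lia.
Qed.

(** * Mertens' estimates *)

Lemma prime_dvd_fact p n : prime p -> (p %| n`!) = (p <= n).
Proof.
move=> pp; elim: n => [|n IH]; first by rewrite dvdn1 leqn0; case: p pp => [|[]].
rewrite factS Euclid_dvdM // IH; apply/idP/idP => [/orP[/dvdn_leq|]|]; try lia.
by rewrite leq_eqVlt => /orP[/eqP->|]; rewrite ?dvdnn // ltnS => ->; rewrite orbT.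
Qed.

Lemma primorial_le_mul a b N : a <= b -> 0 < N ->
  (forall p, prime p -> a < p <= b -> p %| N) -> primorial b <= primorial a * N.
Proof.
move=> ab N0 h; apply: dvdn_leq; first by rewrite muln_gt0 primorial_gt0.
suff: forall j, j <= b -> a <= j -> primorial j %| primorial a * N by apply.
elim=> [|j IH] jb aj.
  by move: aj; rewrite leqn0 => /eqP->; rewrite dvdn_mulr.
move: aj; rewrite leq_eqVlt => /orP[/eqP->|aj]; first by rewrite dvdn_mulr.
have {}IH := IH (ltnW jb) aj.
rewrite primorialS; case: ifP => // jp.
rewrite Gauss_dvd ?IH ?andbT; last by rewrite prime_coprime // prime_dvd_primorial // ltnn.
by rewrite dvdn_mull // h // jb andbT.
Qed.

(** The two central terms in the expansion of (1 + 1)^(2m+1) are equal. *)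
Lemma central_bin_le m : 'C(m.*2.+1, m) <= 4 ^ m.
Proof.
have : 'C(m.*2.+1, m) + 'C(m.*2.+1, m.+1) <= 2 ^ m.*2.+1.
  rewrite -[2]/(1 + 1) expnDn.
  have lm : m < m.*2.+2 by lia.
  have lm1 : m.+1 < m.*2.+2 by lia.
  rewrite (bigD1 (Ordinal lm)) //= (bigD1 (Ordinal lm1)) /=; last first.
    by rewrite -val_eqE /=; lia.
  by rewrite !exp1n !muln1 addnA leq_addr.
have -> : 'C(m.*2.+1, m.+1) = 'C(m.*2.+1, m).
  by rewrite -(@bin_sub _ m); [congr 'C(_, _); lia | lia].
by rewrite expnS -mul2n expnM addnn -mul2n leq_pmul2l.
Qed.

(** Erdos's argument: for odd n = 2m+1 every prime in (m+1, 2m+1] divides the central binomial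
    coefficient, and strong induction covers the primes up to m+1. *)
Lemma primorial_le n : primorial n <= 4 ^ n.
Proof.
elim/ltn_ind: n => -[|[|[|n]]] IH; try by rewrite ?primorialS primorial0.
case: (boolP (prime n.+3)) => np; last first.
  rewrite primorialS (negbTE np); apply: leq_trans (IH n.+2 _) _ => //.
  by rewrite leq_exp2l.
have on : odd n.+3 by case: (even_prime np).
pose m := n.+3./2.
have nm : n.+3 = m.*2.+1 by have := odd_double_half n.+3; rewrite on /m; lia.
have := IH m.+1 ltac:(lia).
rewrite nm => h; apply: leq_trans (_ : primorial m.+1 * 'C(m.*2.+1, m) <= _).
  apply: primorial_le_mul; [lia | by rewrite bin_gt0; lia |].
  move=> p pp /andP[mp pm].
  have := bin_fact (n := m.*2.+1) (m := m) ltac:(lia).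
  have -> : m.*2.+1 - m = m.+1 by lia.
  move=> /(congr1 (dvdn p)); rewrite [RHS]prime_dvd_fact // pm.
  rewrite Euclid_dvdM // => /orP[//|]; rewrite Euclid_dvdM // !prime_dvd_fact //; lia.
apply: leq_trans (leq_mul h (central_bin_le m)) _.
by rewrite -expnD leq_exp2l //; lia.
Qed.

Local Open Scope ring_scope.

Section Log.
Variable R : realType.
Implicit Types n m p k : nat.

(** As [ln 0 = 0] here, [lnn] is nonnegative and monotone on all naturals, zero included. *)
Definition lnn n : R := ln (n%:R).

Lemma lnn1 : lnn 1 = 0. Proof. by rewrite /lnn ln1. Qed.

Lemma lnn0 : lnn 0 = 0. Proof. by rewrite /lnn ln0. Qed.

Lemma natr_pos n : (0 < n)%N -> n%:R \is @Num.pos R.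
Proof. by move=> n0; rewrite posrE ltr0n. Qed.

Lemma lnnM n m : (0 < n)%N -> (0 < m)%N -> lnn (n * m) = lnn n + lnn m.
Proof. by move=> n0 m0; rewrite /lnn natrM lnM // natr_pos. Qed.

Lemma lnnX n j : (0 < n)%N -> lnn (n ^ j) = j%:R * lnn n.
Proof. by move=> n0; rewrite /lnn natrX lnXn ?ltr0n // mulr_natl. Qed.

Lemma ler_lnn n m : (n <= m)%N -> lnn n <= lnn m.
Proof.
case: n => [|n] nm; last by rewrite /lnn ler_ln ?ler_nat ?natr_pos //; lia.
by rewrite lnn0; case: m nm => [|m] _; rewrite ?lnn0 // ln_ge0 // ler1n.
Qed.

Lemma lnn_ge0 n : 0 <= lnn n.
Proof. by rewrite -lnn0 ler_lnn. Qed.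

Lemma lnn_gt0 n : (1 < n)%N -> 0 < lnn n.
Proof. by move=> n1; rewrite ln_gt0 // ltr1n. Qed.

Lemma lnn2_le1 : lnn 2 <= 1.
Proof. by rewrite /lnn -[2%:R]/(1 + 1) le_ln1Dx //; lra. Qed.

Lemma lnnS_le n : (0 < n)%N -> lnn n.+1 - lnn n <= n%:R^-1.
Proof.
move=> n0; rewrite /lnn -ln_div ?natr_pos // -natr1 mulrDl divff ?pnatr_eq0 -?lt0n //.
by rewrite mul1r le_ln1Dx // (lt_le_trans (y := 0)) ?oppr_lt0 // invr_ge0.
Qed.

Lemma lnnS_ge n : lnn n <= lnn n.+1. Proof. exact: ler_lnn. Qed.

Lemma exists_lnn_ge (C : R) : exists N : nat, forall n, (N <= n)%N -> C <= lnn n.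
Proof.
have e0 := expR_gt0 C.
exists (Num.trunc (expR C)).+1 => n Nn; rewrite -[C]expRK /lnn ler_ln ?posrE ?ltr0n //; last first.
  exact: leq_trans Nn.
apply: ltW (lt_le_trans (truncnS_gt _) _).
by rewrite ler_nat.
Qed.


Definition psum (f : nat -> R) n : R := \sum_(1 <= p < n.+1 | prime p) f p.

Lemma psum0 f : psum f 0 = 0. Proof. by rewrite /psum big_geq. Qed.

Lemma psumS f n : psum f n.+1 = psum f n + (if prime n.+1 then f n.+1 else 0).
Proof. by rewrite /psum big_mkcond big_nat_recr //= -big_mkcond. Qed.

Lemma psum_ge0 f n : (forall p, 0 <= f p) -> 0 <= psum f n.
Proof. by move=> f0; apply: sumr_ge0. Qed.

Lemma psum_le f g n : (forall p, prime p -> (p <= n)%N -> f p <= g p) -> psum f n <= psum g n.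
Proof.
move=> fg; rewrite /psum big_nat_cond [leRHS]big_nat_cond; apply: ler_sum => p.
by case/andP=> /andP[_ pn] pp; apply: fg.
Qed.

Lemma psumD f g n : psum (fun p => f p + g p) n = psum f n + psum g n.
Proof. by rewrite /psum big_split. Qed.

Lemma psumZ c f n : psum (fun p => c * f p) n = c * psum f n.
Proof. by rewrite /psum big_distrr. Qed.

Lemma lnn_primorial n : lnn (primorial n) = psum lnn n.
Proof.
elim: n => [|n IH]; first by rewrite primorial0 psum0 lnn1.
rewrite primorialS psumS; case: ifP => _; last by rewrite IH addr0.
by rewrite lnnM ?primorial_gt0 // IH addrC.
Qed.

Lemma psum_lnn_le n : psum lnn n <= 2 * n%:R.
Proof.
rewrite -lnn_primorial; apply: le_trans (ler_lnn (primorial_le n)) _.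
have := lnn2_le1; rewrite -[4%N]/(2 ^ 2)%N -expnM lnnX // natrM => h.
have : 0 <= (n%:R : R) by []. nra.
Qed.

Lemma psum_pred1 f q n : prime q -> (q <= n)%N ->
  psum (fun p => (p == q)%:R * f p) n = f q.
Proof.
move=> qp; elim: n => [|n IH] qn; first by have := prime_gt0 qp; lia.
rewrite psumS; have [e|ne] := eqVneq n.+1 q.
  rewrite -{1}e -e in qp *; rewrite qp mul1r /psum big1_seq ?add0r //.
  move=> p /andP[_]; rewrite mem_index_iota => /andP[_ pn].
  by rewrite ltn_eqF // mul0r.
by rewrite IH; [rewrite mul0r if_same addr0 | lia].
Qed.

(** Induction peels off the smallest prime factor. The bound [N] is kept free so that for a
    factorial the sum can run up to [n]. *)
Lemma lnn_factor N m : (0 < m)%N -> (forall p, prime p -> (p %| m)%N -> (p <= N)%N) ->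
  lnn m = psum (fun p => (logn p m)%:R * lnn p) N.
Proof.
elim/ltn_ind: m => m IH m0 h; have [m1|m1] := leqP m 1.
  have -> : m = 1%N by lia.
  by rewrite lnn1 /psum big1 // => p _; rewrite logn1 mul0r.
have qp := pdiv_prime m1; have /dvdnP[m' def] := pdiv_dvd m.
set q := pdiv m in qp def.
have m'0 : (0 < m')%N by move: m0; rewrite def; case: (m').
have q0 := prime_gt0 qp; have q1 := prime_gt1 qp.
have qN : (q <= N)%N by apply: h => //; exact: pdiv_dvd.
rewrite {1}def lnnM // (IH m') //; last 2 first.
- by rewrite def; nia.
- by move=> p pp pm; apply: h => //; rewrite def dvdn_mulr.
rewrite -(psum_pred1 (@lnn) qp qN) -psumD; apply: eq_bigr => p pp.
by rewrite def lognM // natrD mulrDl (logn_prime _ qp).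
Qed.

Lemma lnn_fact n : lnn n`! = psum (fun p => (logn p n`!)%:R * lnn p) n.
Proof. by apply: lnn_factor (fact_gt0 n) _ => p pp; rewrite prime_dvd_fact. Qed.

(** Legendre's formula with the floors dropped; the full geometric series sums to 1 / (p - 1). *)
Lemma logn_fact_le p n : prime p -> (logn p n`!)%:R <= n%:R / (p%:R - 1) :> R.
Proof.
move=> pp; have p1 : 1 < p%:R :> R by rewrite ltr1n prime_gt1.
have p0 : 0 < p%:R :> R by lra.
rewrite logn_fact // natr_sum.
have div k : (n %/ k)%:R <= n%:R / k%:R :> R.
  case: k => [|k]; first by rewrite divn0 invr0 mulr0.
  by rewrite ler_pdivlMr ?ltr0n // -natrM ler_nat leq_trunc_div.
(* The exact partial sum of the geometric series makes the induction close. *)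
suff H m : \sum_(1 <= k < m.+1) (n %/ p ^ k)%:R <= n%:R * ((1 - p%:R ^- m) / (p%:R - 1)) :> R.
  apply: le_trans (H n) _; rewrite ler_wpM2l // -[leRHS]mul1r.
  have p2 : 0 <= (p%:R - 1)^-1 :> R by rewrite invr_ge0; lra.
  by rewrite ler_wpM2r // gerBl invr_ge0 exprn_ge0 // ltW.
elim: m => [|m IH].
  by rewrite big_geq // expr0 invr1 subrr mul0r mulr0.
rewrite big_nat_recr //=; apply: le_trans (lerD IH (div _)) _.
rewrite le_eqVlt; apply/orP; left; apply/eqP; rewrite natrX exprS.
have pm : p%:R ^+ m != 0 :> R by rewrite expf_neq0 // lt0r_neq0.
field; rewrite pm /=; apply/andP; split; lra.
Qed.

(** Only the first term of Legendre's formula is kept. *)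
Lemma logn_fact_ge p n : prime p -> n%:R / p%:R - 1 <= (logn p n`!)%:R :> R.
Proof.
move=> pp; have p0 : 0 < p%:R :> R by rewrite ltr0n prime_gt0.
apply: le_trans (_ : (n %/ p)%:R <= _).
  rewrite lerBlDr ler_pdivrMr // natr1 -natrM ler_nat.
  by rewrite ltnW // ltn_ceil // prime_gt0.
rewrite ler_nat logn_fact //; case: n => [|n]; first by rewrite div0n.
by rewrite big_nat_recl // expn1 leq_addr.
Qed.

Lemma lnn_fact_ge n : n%:R * lnn n - n%:R <= lnn n`!.
Proof.
elim: n => [|n IH]; first by rewrite lnn0 lnn1 mul0r subrr.
rewrite factS lnnM ?fact_gt0 //; case: n IH => [|n IH]; first by rewrite !lnn1; lra.
have n0 : 0 < n.+1%:R :> R by [].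
have : n.+1%:R * (lnn n.+2 - lnn n.+1) <= 1.
  by rewrite mulrC -ler_pdivlMr // mul1r lnnS_le.
rewrite -[n.+2%:R]natr1; lra.
Qed.

Lemma lnn_fact_le n : lnn n`! <= n%:R * lnn n.
Proof.
elim: n => [|n IH]; first by rewrite lnn1 mul0r.
rewrite factS lnnM ?fact_gt0 // -natr1 mulrDl mul1r addrC lerD2r.
by apply: le_trans IH _; rewrite ler_wpM2l // lnnS_ge.
Qed.

(** Multiply by [n] and compare with ln n!: the rounding in [logn_fact_ge] costs at most the sum of
    ln p, which Chebyshev's bound keeps below 2n. *)
Lemma mertens_upper n : psum (fun p => lnn p / p%:R) n <= lnn n + 2.
Proof.
case: n => [|n]; first by rewrite psum0 addr_ge0 ?lnn_ge0.
have n0 : 0 < n.+1%:R :> R by [].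
rewrite -(ler_pM2l n0) mulrDr -psumZ.
have H : psum (fun p => n.+1%:R * (lnn p / p%:R)) n.+1 <= lnn n.+1`! + psum lnn n.+1.
  rewrite lnn_fact -psumD; apply: psum_le => p pp _.
  have := logn_fact_ge n.+1 pp; have := lnn_ge0 p => l0 h.
  have {h} := ler_wpM2r l0 h; rewrite mulrBl mul1r [in leLHS]mulrAC; lra.
by have := lnn_fact_le n.+1; have := psum_lnn_le n.+1; lra.
Qed.

Lemma psum_ln_div_pred_ge n : lnn n - 1 <= psum (fun p => lnn p / (p%:R - 1)) n.
Proof.
case: n => [|n]; first by rewrite psum0 lnn0; lra.
have n0 : 0 < n.+1%:R :> R by [].
rewrite -(ler_pM2l n0) -psumZ.
apply: le_trans (_ : lnn n.+1`! <= _); first by have := lnn_fact_ge n.+1; lra.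
rewrite lnn_fact; apply: psum_le => p pp _.
by rewrite mulrCA mulrC ler_wpM2l ?lnn_ge0 // logn_fact_le.
Qed.

(* [lnn p / (p (p - 1)) <= u p - u (p + 1)] for [u p = (lnn p + 1) / (p - 1)]. *)
Lemma psum_ln_div_sqr_le n : psum (fun p => lnn p / (p%:R * (p%:R - 1))) n <= 2.
Proof.
suff H m : psum (fun p => lnn p / (p%:R * (p%:R - 1))) m.+1 <= 2 - (lnn m.+2 + 1) / m.+1%:R.
  case: n => [|n]; first by rewrite psum0.
  by apply: le_trans (H n) _; rewrite gerBl divr_ge0 // addr_ge0 // lnn_ge0.
elim: m => [|m IH].
  by rewrite psumS psum0 /=; have := lnn2_le1; lra.
rewrite psumS.
have l0 := lnn_ge0 m.+2; have m1 : 0 < m.+1%:R :> R by []; have m2 : 0 < m.+2%:R :> R by [].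
have e : m.+2%:R = m.+1%:R + 1 :> R by rewrite natr1.
have S : lnn m.+2 / (m.+2%:R * (m.+2%:R - 1)) <= (lnn m.+2 + 1) / m.+1%:R - (lnn m.+3 + 1) / m.+2%:R.
  have : m.+2%:R * (lnn m.+3 - lnn m.+2) <= 1.
    by rewrite mulrC -ler_pdivlMr // mul1r lnnS_le.
  have := lnnS_ge m.+2; rewrite e addrK; move: m1.
  move: (m.+1%:R) (lnn m.+2) (lnn m.+3) => a x y a0 xy h.
  have -> : (x + 1) / a - (y + 1) / (a + 1) = ((x + 1) * (a + 1) - (y + 1) * a) / ((a + 1) * a).
    by field; apply/andP; split; lra.
  rewrite ler_pM2r ?invr_gt0 ?mulr_gt0 //; nra.
have S0 : 0 <= lnn m.+2 / (m.+2%:R * (m.+2%:R - 1)).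
  by rewrite divr_ge0 // mulr_ge0 // e addrK.
move: IH S S0; move: (psum _ _) (lnn m.+2 / _) ((lnn m.+2 + 1) / _) ((lnn m.+3 + 1) / _).
by move=> a b c d; case: ifP => _; lra.
Qed.

(** The denominators [p + 1] are those of [mu]. Passing to them from [p - 1] costs at most 2 ln p /
    (p (p - 1)) for each prime, whence the constant 5 = 1 + 2 * 2. *)
Lemma mertens_lower n : lnn n - 5 <= psum (fun p => lnn p / (p%:R + 1)) n.
Proof.
have h1 := psum_ln_div_pred_ge n; have h2 := psum_ln_div_sqr_le n.
suff : psum (fun p => lnn p / (p%:R - 1)) n <=
  psum (fun p => lnn p / (p%:R + 1)) n + 2 * psum (fun p => lnn p / (p%:R * (p%:R - 1))) n by lra.
rewrite -psumZ -psumD; apply: psum_le => p pp _.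
have p1 : 1 < p%:R :> R by rewrite ltr1n prime_gt1.
have -> : lnn p / (p%:R + 1) + 2 * (lnn p / (p%:R * (p%:R - 1))) =
  lnn p * ((p%:R + 1)^-1 + 2 / (p%:R * (p%:R - 1))) by ring.
rewrite ler_wpM2l ?lnn_ge0 //.
have -> : (p%:R + 1)^-1 + 2 / (p%:R * (p%:R - 1)) =
  (p%:R - 1)^-1 * (1 + 2 / (p%:R * (p%:R + 1))) :> R.
  by field; apply/and3P; split; lra.
have i0 : 0 <= (p%:R - 1)^-1 :> R by rewrite invr_ge0; lra.
rewrite ler_peMr // lerDl divr_ge0 // mulr_ge0 //; lra.
Qed.

End Log.

(** * Partial summation against the logarithm *)

Section Abel.
Variable R : realType.
Variables (S m : nat -> R) (C : R).
Hypothesis stepS : forall n, S n.+1 = S n + (m n.+1 - m n) / lnn R n.+1.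

Lemma lnlnS_ge n : (1 < n)%N ->
  (lnn R n.+1 - lnn R n) / lnn R n.+1 <= ln (lnn R n.+1) - ln (lnn R n).
Proof.
move=> n1; have a0 : 0 < lnn R n by exact: lnn_gt0.
have b0 : 0 < lnn R n.+1 by apply: lnn_gt0; lia.
have : ln (1 + (lnn R n / lnn R n.+1 - 1)) <= lnn R n / lnn R n.+1 - 1.
  by apply: le_ln1Dx; rewrite ltrBrDr addrC subrr divr_gt0.
rewrite addrC subrK ln_div ?posrE // mulrBl divff ?lt0r_neq0 //; lra.
Qed.

Lemma lnlnS_le n : (1 < n)%N ->
  ln (lnn R n.+1) - ln (lnn R n) <= (lnn R n.+1 - lnn R n) / lnn R n.
Proof.
move=> n1; have a0 : 0 < lnn R n by exact: lnn_gt0.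
have b0 : 0 < lnn R n.+1 by apply: lnn_gt0; lia.
have : ln (1 + (lnn R n.+1 / lnn R n - 1)) <= lnn R n.+1 / lnn R n - 1.
  by apply: le_ln1Dx; rewrite ltrBrDr addrC subrr divr_gt0.
rewrite addrC subrK ln_div ?posrE // mulrBl divff ?lt0r_neq0 //; lra.
Qed.

(** With [e] the error of [m], shifted to be nonpositive, S n - ln ln n - e n / ln n never
    increases. *)
Lemma abel_upper : (forall n, m n <= lnn R n + C) ->
  exists K, forall n, (1 < n)%N -> S n <= ln (lnn R n) + K.
Proof.
move=> mC; pose e n := m n - lnn R n - C.
have e0 n : e n <= 0 by rewrite /e; have := mC n; lra.
pose K := S 2 - ln (lnn R 2) - e 2 / lnn R 2.
have H n : (1 < n)%N -> S n <= ln (lnn R n) + K + e n / lnn R n.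
  elim: n => // n IH; rewrite ltnS leq_eqVlt => /orP[/eqP<-|n1].
    by rewrite /K; lra.
  have {}IH := IH n1; rewrite stepS.
  have a0 : 0 < lnn R n by exact: lnn_gt0.
  have b0 : 0 < lnn R n.+1 by apply: lnn_gt0; lia.
  have ab : lnn R n <= lnn R n.+1 by exact: lnnS_ge.
  have := lnlnS_ge n1.
  have -> : (m n.+1 - m n) / lnn R n.+1 =
    e n.+1 / lnn R n.+1 - e n / lnn R n.+1 + (lnn R n.+1 - lnn R n) / lnn R n.+1.
    by rewrite -!mulrBl -mulrDl; congr (_ / _); rewrite /e; lra.
  have : e n / lnn R n <= e n / lnn R n.+1.
    by rewrite ler_wnM2l // lef_pV2 ?posrE.
  lra.
exists K => n n1; apply: le_trans (H n n1) _.
by rewrite gerDl pmulr_lle0 // invr_gt0; apply: lnn_gt0.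
Qed.

Lemma abel_lower : (forall n, lnn R n - C <= m n) ->
  exists K, forall n, (1 < n)%N -> ln (lnn R n) - K <= S n.
Proof.
(* The extra 1 gives e n >= 1 >= ln (n + 1) - ln n, which absorbs the difference between dividing
   that increment by ln n and by ln (n + 1). *)
move=> mC; pose e n := m n - lnn R n + C + 1.
have e0 n : 0 <= e n by rewrite /e; have := mC n; lra.
pose K := ln (lnn R 2) + e 2 / lnn R 2 - S 2.
have H n : (1 < n)%N -> ln (lnn R n) - K + e n / lnn R n <= S n.
  elim: n => // n IH; rewrite ltnS leq_eqVlt => /orP[/eqP<-|n1].
    by rewrite /K; lra.
  have {}IH := IH n1; rewrite stepS.
  have a0 : 0 < lnn R n by exact: lnn_gt0.
  have b0 : 0 < lnn R n.+1 by apply: lnn_gt0; lia.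
  have ab : lnn R n <= lnn R n.+1 by exact: lnnS_ge.
  have := lnlnS_le n1.
  have -> : (m n.+1 - m n) / lnn R n.+1 =
    e n.+1 / lnn R n.+1 - e n / lnn R n.+1 + (lnn R n.+1 - lnn R n) / lnn R n.+1.
    by rewrite -!mulrBl -mulrDl; congr (_ / _); rewrite /e; lra.
  have i : (lnn R n.+1)^-1 <= (lnn R n)^-1 by rewrite lef_pV2 ?posrE.
  have : (lnn R n.+1 - lnn R n) * ((lnn R n)^-1 - (lnn R n.+1)^-1) <=
         e n * ((lnn R n)^-1 - (lnn R n.+1)^-1).
    rewrite ler_wpM2r ?subr_ge0 //; apply: le_trans (_ : 1 <= _); last first.
      by rewrite /e; have := mC n; lra.
    apply: le_trans (lnnS_le R (n := n) ltac:(lia)) _.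
    by rewrite invf_le1 ?ltr0n ?ler1n; lia.
  lra.
exists K => n n1; apply: le_trans (H n n1).
by rewrite lerDl divr_ge0 // lnn_ge0.
Qed.

End Abel.

(** * Mertens sum and product over the primes above [w] *)

Section Rough.
Variable R : realType.
Variable w : nat.
Local Notation lnn := (lnn R).

Definition rough_prime p := prime p && (w < p)%N.

(** The mean of ln k when each prime p with w < p <= n divides k independently with probability 1 /
    (p + 1). *)
Definition mu n : R := psum (fun p => if (w < p)%N then lnn p / (p%:R + 1) else 0) n.

(** The sum of 1 / k over all squarefree products k of such primes, hence the factor normalising the
    weights 1 / k to that probability. *)
Definition V n : R := \prod_(1 <= p < n.+1 | rough_prime p) (1 + p%:R^-1).

Lemma muS n : mu n.+1 = mu n + (if rough_prime n.+1 then lnn n.+1 / (n.+1%:R + 1) else 0).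
Proof. by rewrite /mu psumS /rough_prime; case: (prime _). Qed.

Lemma VS n : V n.+1 = V n * (if rough_prime n.+1 then 1 + n.+1%:R^-1 else 1).
Proof. by rewrite /V big_mkcond big_nat_recr //= -big_mkcond. Qed.

Lemma V0 : V 0 = 1. Proof. by rewrite /V big_geq. Qed.

Lemma V_gt0 n : 0 < V n.
Proof. by apply: prodr_gt0 => p _; rewrite ltr_wpDr // invr_ge0. Qed.

Lemma V_factor_ge1 n : 1 <= (if rough_prime n.+1 then 1 + n.+1%:R^-1 else 1 : R).
Proof. by case: ifP => // _; rewrite lerDl invr_ge0. Qed.

Lemma V_leS n : V n <= V n.+1.
Proof. by rewrite VS ler_peMr ?V_factor_ge1 // ltW // V_gt0. Qed.

Lemma V_le n m : (n <= m)%N -> V n <= V m.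
Proof.
elim: m => [|m IH]; first by rewrite leqn0 => /eqP->.
rewrite leq_eqVlt => /orP[/eqP-> //|]; rewrite ltnS => /IH h.
exact: le_trans h (V_leS m).
Qed.

Lemma VS_le2 n : V n.+1 <= 2 * V n.
Proof.
rewrite VS mulrC ler_pM2r ?V_gt0 //; case: ifP => _; last lra.
by rewrite -[leRHS]/(1 + 1) lerD2l invf_le1 ?ltr0n // ler1n.
Qed.

Lemma mu_ge0 n : 0 <= mu n.
Proof.
by apply: psum_ge0 => p; case: ifP => // _; rewrite divr_ge0 ?lnn_ge0 // addr_ge0.
Qed.

Lemma mu_upper n : mu n <= lnn n + 2.
Proof.
apply: le_trans (mertens_upper R n); apply: psum_le => p pp _.
have p0 : 0 < p%:R :> R by rewrite ltr0n prime_gt0.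
case: ifP => _; last by rewrite divr_ge0 ?lnn_ge0.
by rewrite ler_wpM2l ?lnn_ge0 // lef_pV2 ?posrE //; lra.
Qed.

Lemma mu_lower n : lnn n - 5 - psum (fun p => lnn p / p%:R) w <= mu n.
Proof.
have h := mertens_lower R n.
suff H : psum (fun p => lnn p / (p%:R + 1)) n <= mu n + psum (fun p => lnn p / p%:R) w by lra.
have f0 p : 0 <= lnn p / p%:R by rewrite divr_ge0 // lnn_ge0.
have mono a b : (a <= b)%N -> psum (fun p => lnn p / p%:R) a <= psum (fun p => lnn p / p%:R) b.
  elim: b => [|b IH]; first by rewrite leqn0 => /eqP->.
  rewrite leq_eqVlt => /orP[/eqP-> //|]; rewrite ltnS => /IH ab.
  by apply: le_trans ab _; rewrite psumS lerDl; case: ifP.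
(* Up to [w] the capped sum takes each new prime, beyond [w] it is [mu] that does. *)
suff H m : psum (fun p => lnn p / (p%:R + 1)) m <= mu m + psum (fun p => lnn p / p%:R) (minn m w).
  by apply: le_trans (H n) _; rewrite lerD2l mono // geq_minr.
elim: m => [|m IH]; first by rewrite min0n /mu !psum0 addr0.
rewrite psumS muS /rough_prime; case: ifP => /= mp; last first.
  by rewrite !addr0; apply: le_trans IH _; rewrite lerD2l mono //; lia.
case: (boolP (w < m.+1)%N) => wm.
  have -> : minn m.+1 w = minn m w by lia.
  lra.
have -> : minn m.+1 w = m.+1 by lia.
have e : minn m w = m by lia.
rewrite e in IH; rewrite psumS mp addr0.
rewrite addrA; apply: lerD IH _.
have m0 : 0 < m.+1%:R :> R by [].
by rewrite ler_wpM2l ?lnn_ge0 // lef_pV2 ?posrE //; lra.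
Qed.

(** By 1 + x <= exp x it suffices to sum 1 / p, which partial summation of [mertens_upper] bounds by
    ln ln n + O(1). *)
Lemma V_upper : exists2 C, 0 < C & forall n, (1 < n)%N -> V n <= C * lnn n.
Proof.
pose f p : R := if (w < p)%N then p%:R^-1 else 0.
have [||K HK] := @abel_upper R (psum f) (psum (fun p => f p * lnn p)) 2.
- move=> n; rewrite !psumS; congr (_ + _).
  case: ifP => np; last by rewrite addr0 subrr mul0r.
  by rewrite [_ + _ * _]addrC addrK mulfK // lt0r_neq0 // lnn_gt0 // prime_gt1.
- move=> n; apply: le_trans (mertens_upper R n); apply: psum_le => p pp _; rewrite /f.
  by case: ifP => _; rewrite ?mul0r ?divr_ge0 ?lnn_ge0 // mulrC.
exists (expR K); first exact: expR_gt0.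
move=> n n1; apply: le_trans (_ : expR (psum f n) <= _); last first.
  have l0 : 0 < lnn n by exact: lnn_gt0.
  by rewrite mulrC -[X in X * _]lnK ?posrE // -expRD ler_expR HK.
elim: {n1} n => [|n IH]; first by rewrite V0 psum0 expR0.
rewrite VS psumS expRD; apply: ler_pM => //; [exact/ltW/V_gt0 | exact: le_trans ler01 (V_factor_ge1 n) | ].
by rewrite /rough_prime /f; case: (prime _) => /=; rewrite ?expR0 //; case: ifP => _; rewrite ?expR0 // expR_ge1Dx.
Qed.

(** Since 1 - 1 / (p + 1) is the inverse of 1 + 1 / p, one has 1 + 1 / p >= exp (1 / (p + 1)); the
    exponents are summed from [mu] by parts. *)
Lemma V_lower : exists2 c, 0 < c & forall n, (1 < n)%N -> c * lnn n <= V n.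
Proof.
pose f p : R := if (w < p)%N then (p%:R + 1)^-1 else 0.
have [||K HK] := @abel_lower R (psum f) mu (5 + psum (fun p => lnn p / p%:R) w).
- move=> n; rewrite psumS muS; congr (_ + _); rewrite addrAC subrr add0r /f /rough_prime.
  case: (boolP (prime n.+1)) => /= np; last by rewrite mul0r.
  case: ifP => _; last by rewrite mul0r.
  by rewrite mulrAC divff ?mul1r // lt0r_neq0 // lnn_gt0 // prime_gt1.
- by move=> n; have := mu_lower n; lra.
exists (expR (- K)); first exact: expR_gt0.
move=> n n1; apply: le_trans (_ : expR (psum f n) <= _).
  have l0 : 0 < lnn n by exact: lnn_gt0.
  by rewrite mulrC -[X in X * _]lnK ?posrE // -expRD ler_expR HK.
elim: {n1} n => [|n IH]; first by rewrite V0 psum0 expR0.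
rewrite VS psumS expRD; apply: ler_pM => //; try exact: expR_ge0.
rewrite /rough_prime /f; case: (prime _) => /=; rewrite ?expR0 //; case: ifP => _; rewrite ?expR0 //.
have := expR_ge1Dx (- (n.+1%:R + 1)^-1 : R); rewrite expRN.
have n0 : 0 < n.+1%:R :> R by [].
have e : 1 - (n.+1%:R + 1)^-1 = (1 + n.+1%:R^-1)^-1 :> R.
  by move: n0; move: (n.+1%:R : R) => a a0; field; apply/andP; split; lra.
by rewrite e lef_pV2 // posrE ?expR_gt0 // ltr_wpDr // invr_ge0.
Qed.

End Rough.

(** Makes the primorial large enough to push the deviation at death below any chosen level. Each
    prime satisfies ln p / (p + 1) + 2 ln p / p <= 2 ln p, and the sum of the first terms is
    unbounded. *)
Lemma exists_rough_bound (R : realType) (C : R) :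
  exists w, C + psum (fun p => lnn R p / p%:R) w <= lnn R (primorial w).
Proof.
have [N HN] := exists_lnn_ge (2 * C + 5); exists N.
have h := HN N (leqnn N); have h5 := mertens_lower R N; rewrite lnn_primorial.
suff : psum (fun p => lnn R p / (p%:R + 1)) N + 2 * psum (fun p => lnn R p / p%:R) N
   <= 2 * psum (lnn R) N by lra.
rewrite -!psumZ -psumD; apply: psum_le => p pp _.
have l0 := lnn_ge0 R p.
have p2 : 2 <= p%:R :> R by rewrite ler_nat prime_gt1.
have i1 : (p%:R + 1)^-1 <= 2^-1 :> R by rewrite lef_pV2 ?posrE; lra.
have i2 : p%:R^-1 <= 2^-1 :> R by rewrite lef_pV2 ?posrE; lra.
have := ler_wpM2l l0 i1; have := ler_wpM2l l0 i2; lra.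
Qed.

(** * The alive products and their moments *)

Section Alive.
Variables w t : nat.
Local Notation rough_prime := (rough_prime w).

(** Passing from [m] to [m + 1] first drops the products with [t * k <= m]; if [m + 1] is a rough
    prime, each remaining one is kept both with and without that factor. *)
Fixpoint alive n : seq nat :=
  if n is m.+1 then
    let s := [seq k <- alive m | (m < t * k)%N] in
    if rough_prime m.+1 then s ++ map (muln m.+1) s else s
  else [:: 1%N].

Definition survivors n := [seq k <- alive n | (n < t * k)%N].

Lemma aliveS n : alive n.+1 =
  if rough_prime n.+1 then survivors n ++ map (muln n.+1) (survivors n) else survivors n.
Proof. by []. Qed.

Lemma mem_survivors k n : (k \in survivors n) = (n < t * k)%N && (k \in alive n).
Proof. by rewrite mem_filter. Qed.

Lemma alive_ind (P : nat -> nat -> Prop) : P 0%N 1%N ->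
  (forall n k, k \in survivors n -> P n k -> P n.+1 k) ->
  (forall n k, k \in survivors n -> rough_prime n.+1 -> P n k -> P n.+1 (n.+1 * k)%N) ->
  forall n k, k \in alive n -> P n k.
Proof.
move=> P0 PS PM; elim=> [|n IH] k; first by rewrite inE => /eqP->.
have IH' j : j \in survivors n -> P n j by rewrite mem_survivors => /andP[_ /IH].
rewrite aliveS; case: ifP => np; last by move=> ks; apply: PS => //; apply: IH'.
rewrite mem_cat => /orP[ks|/mapP[j js ->]]; first by apply: PS => //; apply: IH'.
by apply: PM => //; apply: IH'.
Qed.

Lemma alive_gt0 n k : k \in alive n -> (0 < k)%N.
Proof. by move: n k; apply: alive_ind => // n k _ _ k0; rewrite muln_gt0. Qed.

Lemma alive_smooth n k p : k \in alive n -> prime p -> (p %| k)%N -> (w < p <= n)%N.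
Proof.
move=> + pp; move: n k; apply: (alive_ind (P := fun n k => p %| k -> w < p <= n)%N).
- by rewrite dvdn1 => /eqP e; rewrite e in pp.
- by move=> n k _ IH /IH; lia.
move=> n k _ /andP[np wn] IH; rewrite Euclid_dvdM // => /orP[|/IH]; last lia.
by rewrite dvdn_prime2 // => /eqP->; rewrite wn leqnn.
Qed.

Lemma alive_coprime n k p : k \in alive n -> prime p -> (n < p)%N -> ~~ (p %| k)%N.
Proof. by move=> kn pp np; apply/negP => /(alive_smooth kn pp); lia. Qed.

(** A survivor has [t * k >= n + 1] and multiplication only enlarges it. So a product can die at [n]
    only with [t * k = n]. *)
Lemma alive_ge n k : k \in alive n -> (n <= t * k)%N.
Proof.
move: n k; apply: alive_ind => // n k; rewrite mem_survivors => /andP[h _] // _ IH.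
by nia.
Qed.

Lemma alive_uniq n : uniq (alive n).
Proof.
elim: n => // n IH; rewrite aliveS.
have su : uniq (survivors n) by rewrite filter_uniq.
case: ifP => // /andP[np wn]; rewrite cat_uniq su map_inj_uniq ?su ?andbT /=; last first.
  by move=> a b /eqP; rewrite eqn_pmul2l // => /eqP.
apply/hasPn => x /mapP[j _ ->]; rewrite /= mem_survivors; apply/negP => /andP[_ h].
by have := alive_coprime h np (ltnSn n); rewrite dvdn_mulr.
Qed.

(** Inserting a missing prime never shrinks a partial product, so every survival test passed before
    is still passed. *)
Lemma alive_mul n k q : k \in alive n -> prime q -> (w < q <= n)%N ->
  ~~ (q %| k)%N -> (q * k)%N \in alive n.
Proof.
move=> + qp; elim: n k => [|n IH] k kn /andP[wq qn] qk; first by lia.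
have [e|ne] := eqVneq q n.+1.
  move: kn; rewrite aliveS -e /rough_prime qp wq /= !mem_cat => /orP[ks|/mapP[j _ ej]].
    by rewrite map_f ?orbT.
  by rewrite ej dvdn_mulr in qk.
have sm j : j \in survivors n -> ~~ (q %| j)%N -> (q * j)%N \in survivors n.
  rewrite !mem_survivors => /andP[h jn] qj; rewrite IH ?andbT //; last lia.
  by have := prime_gt0 qp; nia.
move: kn; rewrite aliveS; case: ifP => np; last by move=> /sm; apply.
rewrite !mem_cat => /orP[ks|/mapP[j js ej]]; first by rewrite sm.
have qj : ~~ (q %| j)%N by apply: contra qk => h; rewrite ej dvdn_mull.
by apply/orP; right; rewrite ej mulnCA map_f ?sm.
Qed.

Hypothesis t_practical : sf_practical t.
Hypothesis t_smooth : forall p, prime p -> (w < p)%N -> ~~ (p %| t)%N.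

Lemma alive_practical n k : k \in alive n -> sf_practical (t * k).
Proof.
move: n k; apply: alive_ind => [|//|]; first by rewrite muln1.
move=> n k; rewrite mem_survivors => /andP[h kn] /andP[np wn] IH.
rewrite mulnCA; apply: sf_practical_mul => //; last lia.
by rewrite Euclid_dvdM // negb_or t_smooth //= (alive_coprime kn).
Qed.

End Alive.

(** * Weighted moments of the deviation *)

Section Moments.
Variable R : realType.
Variables w t : nat.
Local Notation lnn := (lnn R).
Local Notation mu := (mu R w).
Local Notation V := (V R w).
Local Notation alive := (alive w t).
Local Notation survivors := (survivors w t).
Local Notation rough_prime := (rough_prime w).

(** Up to the factor [V n], the expectation of [F] restricted to the random products listed in
    [s]. *)
Definition wsum (s : seq nat) (F : nat -> R) : R := \sum_(k <- s) F k / k%:R.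

Lemma wsum_ge0 s F : (forall k, k \in s -> 0 <= F k) -> 0 <= wsum s F.
Proof. by move=> F0; rewrite /wsum big_seq sumr_ge0 // => k /F0 h; rewrite divr_ge0. Qed.

Lemma wsum_le s F G : (forall k, k \in s -> F k <= G k) -> wsum s F <= wsum s G.
Proof.
move=> FG; rewrite /wsum big_seq [leRHS]big_seq; apply: ler_sum => k ks.
by rewrite ler_wpM2r ?invr_ge0 // FG.
Qed.

Lemma wsum_eq s F G : (forall k, k \in s -> F k = G k) -> wsum s F = wsum s G.
Proof. by move=> FG; apply: eq_big_seq => k ks; rewrite FG. Qed.

Lemma wsumD s F G : wsum s (fun k => F k + G k) = wsum s F + wsum s G.
Proof. by rewrite /wsum -big_split; apply: eq_bigr => k _; rewrite mulrDl. Qed.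

Lemma wsumZ s c F : wsum s (fun k => c * F k) = c * wsum s F.
Proof. by rewrite /wsum big_distrr /=; apply: eq_bigr => k _; rewrite mulrA. Qed.

Lemma wsum_aliveS n F : wsum (alive n.+1) F = wsum (survivors n)
  (fun k => F k + (if rough_prime n.+1 then F (n.+1 * k)%N / n.+1%:R else 0)).
Proof.
rewrite aliveS; case: ifP => np; last by apply: wsum_eq => k _; rewrite addr0.
rewrite /wsum big_cat big_map /= -big_split /=; apply: eq_bigr => k _.
by rewrite mulrDl natrM invfM mulrA.
Qed.

Lemma wsum_survivors_ge n F : (forall k, k \in alive n -> (t * k)%N = n -> F k <= 0) ->
  wsum (alive n) F <= wsum (survivors n) F.
Proof.
move=> F0; rewrite /wsum big_filter [leLHS](bigID (fun k => (n < t * k)%N)) /= gerDl.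
rewrite big_seq_cond; apply: sumr_le0 => k /andP[kn nk].
have := alive_ge kn; rewrite -leqNgt in nk => h.
rewrite mulr_le0_ge0 ?invr_ge0 // F0 //; lia.
Qed.

Lemma wsum_survivors_le n F : (forall k, k \in alive n -> (t * k)%N = n -> 0 <= F k) ->
  wsum (survivors n) F <= wsum (alive n) F.
Proof.
move=> F0; rewrite /wsum big_filter [leRHS](bigID (fun k => (n < t * k)%N)) /= lerDl.
rewrite big_seq_cond; apply: sumr_ge0 => k /andP[kn nk].
have := alive_ge kn; rewrite -leqNgt in nk => h.
rewrite divr_ge0 // F0 //; lia.
Qed.

Definition dev n k : R := lnn k - mu n.

(* [mu] is chosen so that the deviation is a martingale. *)
Lemma wsum_devS n c : wsum (alive n.+1) (fun k => dev n.+1 k + c) =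
  (if rough_prime n.+1 then 1 + n.+1%:R^-1 else 1) * wsum (survivors n) (fun k => dev n k + c).
Proof.
rewrite wsum_aliveS -wsumZ; apply: wsum_eq => k; rewrite mem_survivors => /andP[_ kn].
rewrite /dev muS; case: ifP => np; last by rewrite addr0 mul1r addr0.
rewrite lnnM ?(alive_gt0 kn) //.
have n0 : 0 < n.+1%:R :> R by [].
move: n0; move: (n.+1%:R : R) (lnn n.+1) (lnn k) (mu n) => a x y m a0.
by field; apply/andP; split; lra.
Qed.

(** The choice of [mu] kills the cross term. What is added is the variance of ln p times a Bernoulli
    variable of parameter 1 / (p + 1). *)
Lemma wsum_dev2S n : wsum (alive n.+1) (fun k => dev n.+1 k ^+ 2) =
  (if rough_prime n.+1 then 1 + n.+1%:R^-1 else 1) *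
  (wsum (survivors n) (fun k => dev n k ^+ 2) +
   (if rough_prime n.+1 then n.+1%:R * lnn n.+1 ^+ 2 / (n.+1%:R + 1) ^+ 2 else 0)
     * wsum (survivors n) (fun=> 1)).
Proof.
rewrite wsum_aliveS -[X in _ * (_ + X)]wsumZ -wsumD -wsumZ.
apply: wsum_eq => k; rewrite mem_survivors => /andP[_ kn].
rewrite /dev muS; case: ifP => np; last by rewrite mul0r mul1r !addr0.
rewrite lnnM ?(alive_gt0 kn) //.
have n0 : 0 < n.+1%:R :> R by [].
move: n0; move: (n.+1%:R : R) (lnn n.+1) (lnn k) (mu n) => a x y m a0.
by field; apply/andP; split; lra.
Qed.

Lemma wsum_alive0 F : wsum (alive 0) F = F 1%N.
Proof. by rewrite /wsum big_seq1 invr1 mulr1. Qed.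

Hypothesis t_gt0 : (0 < t)%N.
Hypothesis t_large : forall n, lnn n - mu n + 1 <= lnn t.

Lemma dead_lnn n k : k \in alive n -> (t * k)%N = n -> lnn k = lnn n - lnn t.
Proof. by move=> kn <-; rewrite lnnM // ?(alive_gt0 kn) // addrAC subrr add0r. Qed.

(** Optional stopping: [dev + 1] starts at 1, and a product dying at [n] has dev + 1 = ln n - ln t -
    mu n + 1 <= 0 by [t_large], so discarding it cannot lower the sum. *)
Lemma first_moment_lower n : V n <= wsum (alive n) (fun k => dev n k + 1).
Proof.
elim: n => [|n IH].
  by rewrite wsum_alive0 V0 /dev /mu psum0 lnn1; lra.
rewrite wsum_devS VS mulrC ler_wpM2l //; first exact: le_trans ler01 (V_factor_ge1 _ _ _).
apply: le_trans IH _; apply: wsum_survivors_ge => k kn e.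
by rewrite /dev (dead_lnn kn e); have := t_large n; lra.
Qed.

Lemma lnn_alive_ge n k : k \in alive n -> lnn n - lnn t <= lnn k.
Proof.
move=> kn; rewrite lerBlDl -lnnM // ?(alive_gt0 kn) //.
by apply: ler_lnn; apply: alive_ge kn.
Qed.

Lemma dev_ge n k : k \in alive n -> 0 <= dev n k + (lnn t + 2).
Proof. by move=> /lnn_alive_ge h; have := mu_upper R w n; rewrite /dev; lra. Qed.

(** Optional stopping from the other side: the shift by ln t + 2 makes every term nonnegative, so
    discarding products can only lower the sum. *)
Lemma first_moment_upper n :
  wsum (alive n) (fun k => dev n k + (lnn t + 2)) <= (lnn t + 2) * V n.
Proof.
elim: n => [|n IH].
  by rewrite wsum_alive0 V0 /dev /mu psum0 lnn1; lra.
rewrite wsum_devS VS [V n * _]mulrC mulrCA ler_wpM2l //; first exact: le_trans ler01 (V_factor_ge1 _ _ _).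
apply: le_trans IH; apply: wsum_survivors_le => k kn _; exact: dev_ge.
Qed.

Definition mass n : R := wsum (alive n) (fun=> 1).

Lemma mass_survivors_le n : wsum (survivors n) (fun=> 1) <= mass n.
Proof. by apply: wsum_survivors_le. Qed.

Lemma mass_le_V n : mass n <= V n.
Proof.
elim: n => [|n IH]; first by rewrite /mass wsum_alive0 V0.
rewrite /mass wsum_aliveS VS [V n * _]mulrC.
rewrite (@wsum_eq _ _ (fun=> (if rough_prime n.+1 then 1 + n.+1%:R^-1 else 1) * 1)); last first.
  by move=> k _; case: ifP => _; rewrite ?mulr1 ?addr0 // mul1r.
rewrite wsumZ ler_wpM2l //; first exact: le_trans ler01 (V_factor_ge1 _ _ _).
exact: le_trans (mass_survivors_le n) IH.
Qed.

(** With the mass bounded, a prime p adds variance at most C ln^2 p / p. As c ln p <= V p <= 2 V (p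
    - 1), one factor ln p is traded for [V], and Mertens sums the remaining ln p / p. *)
Lemma second_moment_upper C c : 0 < c ->
  (forall n, mass n <= C) -> (forall n, (1 < n)%N -> c * lnn n <= V n) ->
  forall n, wsum (alive n) (fun k => dev n k ^+ 2) <= 2 * C / c * V n * (lnn n + 2).
Proof.
move=> c0 massC Vc n.
have C0 : 0 <= C by apply: le_trans (massC 0%N); apply: wsum_ge0.
apply: le_trans (_ : 2 * C / c * V n * psum (fun p => lnn p / p%:R) n <= _); last first.
  rewrite ler_wpM2l ?mertens_upper // mulr_ge0 ?(ltW (V_gt0 _ _ _)) //.
  by rewrite divr_ge0 ?(ltW c0) // mulr_ge0.
elim: n => [|n IH].
  by rewrite wsum_alive0 psum0 /dev /mu psum0 lnn1 subr0 expr0n mulr0.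
rewrite wsum_dev2S VS psumS.
set v := (if rough_prime n.+1 then 1 + _ else 1).
have v0 : 0 <= v by exact: le_trans ler01 (V_factor_ge1 _ _ _).
have -> : 2 * C / c * (V n * v) = v * (2 * C / c * V n) by ring.
rewrite -[leRHS]mulrA ler_wpM2l // mulrDr; apply: lerD.
  apply: le_trans IH; apply: wsum_survivors_le => k _ _; exact: sqr_ge0.
have Vn0 := V_gt0 R w n.
have K0 : 0 <= 2 * C / c * V n by rewrite mulr_ge0 ?(ltW Vn0) // divr_ge0 ?(ltW c0) // mulr_ge0.
have P0 : 0 <= (if prime n.+1 then lnn n.+1 / n.+1%:R else 0).
  by case: ifP => // _; rewrite divr_ge0 // lnn_ge0.
case: ifP => np; last by rewrite mul0r mulr_ge0.
move: (np) => /andP[pp _]; rewrite pp.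
have l0 : 0 < lnn n.+1 by apply: lnn_gt0; exact: prime_gt1.
have n0 : 0 < n.+1%:R :> R by [].
have h1 : wsum (survivors n) (fun=> 1) <= C := le_trans (mass_survivors_le n) (massC n).
have h2 : c * lnn n.+1 <= 2 * V n := le_trans (Vc _ (prime_gt1 pp)) (VS_le2 R w n).
have h3 : n.+1%:R * lnn n.+1 ^+ 2 / (n.+1%:R + 1) ^+ 2 <= lnn n.+1 ^+ 2 / n.+1%:R.
  rewrite -[leLHS]mulrA mulrCA ler_wpM2l ?sqr_ge0 //.
  rewrite ler_pdivrMr ?exprn_gt0 ?addr_gt0 // -ler_pdivrMl ?invr_gt0 // invrK.
  by move: n0; move: (n.+1%:R : R) => a a0; nra.
apply: le_trans (_ : lnn n.+1 ^+ 2 / n.+1%:R * C <= _).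
  apply: ler_pM => //; last exact: wsum_ge0.
  by rewrite divr_ge0 ?sqr_ge0 // mulr_ge0 // sqr_ge0.
have -> : 2 * C / c * V n * (lnn n.+1 / n.+1%:R) = (2 * V n / c) * (lnn n.+1 / n.+1%:R * C).
  by ring.
have -> : lnn n.+1 ^+ 2 / n.+1%:R * C = lnn n.+1 * (lnn n.+1 / n.+1%:R * C) by ring.
rewrite ler_wpM2r ?mulr_ge0 ?invr_ge0 ?(ltW l0) // ler_pdivlMr //; lra.
Qed.

End Moments.

(** * Raising the alive products to a fixed scale *)

Lemma ler_sum_subset (R : numDomainType) (T : eqType) (s1 s2 : seq T) (F : T -> R) :
  uniq s1 -> uniq s2 -> {subset s1 <= s2} -> (forall x, 0 <= F x) ->
  \sum_(x <- s1) F x <= \sum_(x <- s2) F x.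
Proof.
move=> u1 u2 sub F0.
have pe : perm_eq s1 [seq x <- s2 | x \in s1].
  apply: uniq_perm; rewrite ?filter_uniq // => x; rewrite mem_filter.
  by case: (boolP (x \in s1)) => //= /sub ->.
by rewrite (perm_big _ pe) big_filter [leRHS](bigID (mem s1)) /= lerDl sumr_ge0.
Qed.

(** * Primes in intervals and primes above the square root *)

Section PrimeIntervals.
Variable R : realType.
Local Notation lnn := (lnn R).

Lemma psum_split f a b : (a <= b)%N ->
  psum f b = psum f a + \sum_(a.+1 <= p < b.+1 | prime p) f p :> R.
Proof. by move=> ab; rewrite /psum (@big_cat_nat _ _ _ a.+1). Qed.

Lemma mertens_interval a b : (a <= b)%N ->
  lnn b - lnn a - 7 <= \sum_(a.+1 <= p < b.+1 | prime p) lnn p / p%:R.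
Proof.
move=> ab; have := psum_split (fun p => lnn p / p%:R) ab.
have := mertens_upper R a; have := mertens_lower R b.
have : psum (fun p => lnn p / (p%:R + 1)) b <= psum (fun p => lnn p / p%:R) b.
  apply: psum_le => p pp _; have p0 : 0 < p%:R :> R by rewrite ltr0n prime_gt0.
  by rewrite ler_wpM2l ?lnn_ge0 // lef_pV2 ?posrE //; lra.
lra.
Qed.

(** If ln D >= 8, the Mertens sum over (Y / D, Y] is at least 8 - 7 = 1, while each of its terms is
    at most D ln Y / Y. *)
Lemma many_primes : exists2 D, (0 < D)%N & forall Y, (D <= Y)%N ->
  Y%:R <= D%:R * lnn Y * (count prime (index_iota (Y %/ D).+1 Y.+1))%:R.
Proof.
have [D HD] := exists_lnn_ge (8 : R).
have D1 : (1 < D.+2)%N by [].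
exists D.+2 => // Y DY; set a := (Y %/ D.+2)%N.
have a0 : (0 < a)%N by rewrite divn_gt0.
have aY : (a <= Y)%N by rewrite leq_div.
have h1 : 1 <= \sum_(a.+1 <= p < Y.+1 | prime p) lnn p / p%:R.
  apply: le_trans (mertens_interval aY).
  have : lnn D.+2 + lnn a <= lnn Y by rewrite -lnnM // ler_lnn // mulnC leq_trunc_div.
  have := HD D.+2 ltac:(lia); lra.
have Y0 : 0 < Y%:R :> R by rewrite ltr0n; lia.
rewrite -sum1_count natr_sum big_distrr /= -[leLHS]mulr1 -ler_pdivlMl //.
apply: le_trans h1 _; rewrite big_distrr /= big_nat_cond [leRHS]big_nat_cond.
apply: ler_sum => p /andP[/andP[ap pY] pp].
have p0 : 0 < p%:R :> R by rewrite ltr0n prime_gt0.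
rewrite mulr1 [D.+2%:R * _]mulrC mulrCA; apply: ler_pM.
- exact: lnn_ge0.
- by rewrite invr_ge0.
- exact: ler_lnn.
rewrite ler_pdivlMl // ler_pdivrMr // -natrM ler_nat.
by rewrite mulnC ltnW // (leq_trans (ltn_ceil Y (d := D.+2) _)) // leq_mul2r ap orbT.
Qed.

Definition big_primes n := [seq q <- index_iota 1 n.+1 | prime q && (n < q * q)%N].

Lemma mem_big_primes n q : (q \in big_primes n) = [&& prime q, (n < q * q)%N & (q <= n)%N].
Proof.
rewrite mem_filter mem_index_iota ltnS -andbA.
by case: (boolP (prime q)) => // /prime_gt0 ->.
Qed.

Lemma big_primes_uniq n : uniq (big_primes n).
Proof. by rewrite filter_uniq // iota_uniq. Qed.

(** Over the primes between sqrt n and n the Mertens sum is at least (ln n) / 2 - 7, which is at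
    least (ln n) / 4 once ln n >= 28; divide by ln n. *)
Lemma sum_big_primes_ge : exists N, forall n, (N <= n)%N ->
  4^-1 <= \sum_(q <- big_primes n) q%:R^-1 :> R.
Proof.
have [N HN] := exists_lnn_ge (28 : R); exists N.+1 => n Nn.
have ln28 := HN n (ltnW Nn).
have l0 : 0 < lnn n by lra.
have n0 : (0 < n)%N by lia.
have [r [r1 r2 r3]] : exists r, [/\ (r <= n)%N, (r * r <= n)%N & (n < r.+1 * r.+1)%N].
  elim: (n) => [|m [r [h1 h2 h3]]]; first by exists 0%N.
  have [h|h] := leqP (r.+1 * r.+1) m.+1; last by exists r; split; lia.
  by exists r.+1; split; nia.
have lr : 2 * lnn r <= lnn n.
  have [->|r0] := posnP r; first by rewrite lnn0; lra.
  by have := ler_lnn R r2; rewrite lnnM //; lra.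
have h := mertens_interval r1.
have H : \sum_(r.+1 <= p < n.+1 | prime p) lnn p / p%:R <=
         \sum_(q <- big_primes n) lnn n * q%:R^-1.
  apply: le_trans (_ : \sum_(q <- [seq p <- index_iota r.+1 n.+1 | prime p]) lnn n * q%:R^-1 <= _).
    rewrite big_filter [leLHS]big_nat_cond [leRHS]big_nat_cond; apply: ler_sum => p /andP[/andP[_ pn] _].
    by rewrite ler_wpM2r ?invr_ge0 // ler_lnn.
  apply: ler_sum_subset; rewrite ?filter_uniq ?iota_uniq //; last first.
    by move=> q; rewrite mulr_ge0 ?invr_ge0 // ltW.
  move=> q; rewrite mem_filter mem_index_iota mem_big_primes => /and3P[-> rq qn] /=.
  by apply/andP; split; nia.
rewrite -big_distrr /= in H.
rewrite -(ler_pM2l l0); lra.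
Qed.

Definition omega n k := count (fun q => (q %| k)%N) (big_primes n).

(** The big primes dividing [k] have their product dividing [k], and each exceeds sqrt n; 2J of them
    would force [k >= n ^ J]. *)
Lemma omega_lt n k J : (0 < k < n ^ J)%N -> (omega n k < 2 * J)%N.
Proof.
move=> /andP[k0 kJ]; rewrite ltnNge; apply/negP => h.
have n0 : (0 < n)%N by case: n kJ h => //; case: J => //= ; rewrite ?expn0; lia.
pose s := [seq q <- big_primes n | (q %| k)%N].
have sE : size s = omega n k by rewrite size_filter.
have sp q : q \in s -> [/\ prime q, (n < q * q)%N & (q %| k)%N].
  by rewrite mem_filter mem_big_primes => /and4P[-> -> -> _].
have su : uniq s by rewrite filter_uniq // big_primes_uniq.
have [d1 d2] : (\prod_(q <- s) q %| k)%N /\ (n ^ size s <= (\prod_(q <- s) q) ^ 2)%N.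
  elim: (s) su sp => [|q u IH] /=; first by rewrite big_nil.
  move=> /andP[qu uu] sp; have [qp nq qk] := sp q (mem_head _ _).
  have [|u1 u2] := IH uu; first by move=> x xu; apply: sp; rewrite inE xu orbT.
  rewrite big_cons Gauss_dvd ?qk ?u1; last first.
    rewrite big_seq; apply: (big_ind (fun y => coprime q y)) => [|x y qx qy|x xu].
    - exact: coprimen1.
    - by rewrite coprimeMr qx.
    have [xp _ _] : [/\ prime x, (n < x * x)%N & (x %| k)%N] by apply: sp; rewrite inE xu orbT.
    by rewrite prime_coprime // dvdn_prime2 //; apply: contra qu => /eqP->.
  split=> //; rewrite expnMn expnS leq_mul // -mulnn ltnW //.
have kle := dvdn_leq k0 d1.
have : (n ^ (2 * J) <= k ^ 2)%N.
  apply: leq_trans (_ : n ^ size s <= _)%N; first by rewrite leq_pexp2l // sE.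
  by apply: leq_trans d2 _; rewrite leq_exp2r.
by rewrite mulnC expnM leq_exp2r // leqNgt kJ.
Qed.
End PrimeIntervals.

Section PushUp.
Variable R : realType.
Variables w t : nat.
Local Notation lnn := (lnn R).
Local Notation alive := (alive w t).

(** The threshold [j] grades the products below [n ^ J] by their big prime factors; [push_up] climbs
    along it. *)
Definition low_sum J n j : R :=
  \sum_(k <- alive n | (k < n ^ J)%N && (j <= omega n k)%N) k%:R^-1.

Definition window_sum J n : R :=
  \sum_(k <- alive n | (n ^ J <= k < n ^ J.+1)%N) k%:R^-1.

Lemma window_sum_ge0 J n : 0 <= window_sum J n.
Proof. by apply: sumr_ge0 => k _; rewrite invr_ge0. Qed.

Lemma omega_mul n k q : q \in big_primes n -> ~~ (q %| k)%N -> (omega n k < omega n (q * k))%N.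
Proof.
move=> qn qk; rewrite /omega.
have <- : (count (fun x => (x %| k)%N) (big_primes n) + count (pred1 q) (big_primes n))%N =
  (count (fun x => (x %| k)%N) (big_primes n)).+1.
  by rewrite [count (pred1 q) _]count_uniq_mem ?big_primes_uniq // qn addn1.
rewrite -count_predUI addnC (@eq_count _ _ pred0) ?count_pred0 ?add0n; last first.
  by move=> x /=; case: eqP => [->|]; rewrite ?(negbTE qk) ?andbF.
apply: sub_count => x /= /orP[h|/eqP->]; first by rewrite dvdn_mull.
by rewrite dvdn_mulr.
Qed.

(* Multiply [k] by the big primes [q] not dividing it: a product [k'] arises from
   at most [omega n k'] pairs [(q, k)], and [omega] is bounded below [n ^ J.+1]. *)
Lemma low_sum_step J : exists N, forall n j, (N <= n)%N ->
  low_sum J n j <= (16 * (J + 1))%:R * (low_sum J n j.+1 + window_sum J n).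
Proof.
have [N0 HN0] := sum_big_primes_ge R.
(* Once n >= M^2 every big prime is at least M, so the fewer than 2J of them dividing [k] remove at
   most 1/8 from the sum 1/4. Likewise n >= w^2 puts them above [w]. *)
pose M := (16 * (J + 1))%N.
exists (N0 + M * M + w * w + 1)%N => n j Nn.
have n0 : (0 < n)%N by lia.
have inner k : k \in alive n -> (k < n ^ J)%N ->
    8^-1 <= \sum_(q <- big_primes n | ~~ (q %| k)%N) q%:R^-1 :> R.
  move=> kn kJ; have := HN0 n ltac:(lia).
  rewrite (bigID (fun q => q %| k)%N) /=.
  suff : \sum_(q <- big_primes n | (q %| k)%N) q%:R^-1 <= 8^-1 :> R by lra.
  have om : (omega n k < 2 * J)%N by apply: omega_lt; rewrite kJ (alive_gt0 kn).
  have M0 : 0 < M%:R :> R by rewrite ltr0n /M; lia.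
  apply: le_trans (_ : (omega n k)%:R * M%:R^-1 <= _).
    rewrite /omega -sum1_count natr_sum big_distrl /= big_seq_cond [leRHS]big_seq_cond.
    apply: ler_sum => q /andP[]; rewrite mem_big_primes => /and3P[qp nq _] _.
    rewrite mul1r lef_pV2 ?posrE // ?ler_nat ?ltr0n ?prime_gt0 //; nia.
  rewrite ler_pdivrMr // -ler_pdivrMl ?invr_gt0 // invrK -natrM ler_nat /M; lia.
have A1 : 8^-1 * low_sum J n j <=
  \sum_(k <- alive n | (k < n ^ J)%N && (j <= omega n k)%N)
     \sum_(q <- big_primes n | ~~ (q %| k)%N) (q * k)%:R^-1.
  rewrite /low_sum big_distrr /= big_seq_cond [leRHS]big_seq_cond; apply: ler_sum.
  move=> k /and3P[kn kJ _].
  have -> : \sum_(q <- big_primes n | ~~ (q %| k)%N) (q * k)%:R^-1 =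
    (\sum_(q <- big_primes n | ~~ (q %| k)%N) q%:R^-1) * k%:R^-1 :> R.
    by rewrite big_distrl /=; apply: eq_bigr => q _; rewrite natrM invfM.
  by rewrite ler_wpM2r ?invr_ge0 ?inner.
rewrite (exchange_big_dep predT) //= in A1.
(* For fixed [q], multiplication by [q] is injective into the alive multiples of [q] below n^(J+1),
   and it adds a big prime factor. *)
have A2 : 8^-1 * low_sum J n j <= \sum_(q <- big_primes n)
   \sum_(k <- alive n | [&& (k < n ^ J.+1)%N, (j < omega n k)%N & (q %| k)%N]) k%:R^-1.
  apply: le_trans A1 _; rewrite big_seq [leRHS]big_seq; apply: ler_sum => q qn.
  have := qn; rewrite mem_big_primes => /and3P[qp nq qle].
  have q0 := prime_gt0 qp.
  rewrite -[leRHS]big_filter -big_filter.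
  rewrite -(big_map (muln q) predT (fun k => k%:R^-1)).
  apply: ler_sum_subset.
  - rewrite map_inj_uniq ?filter_uniq ?alive_uniq //.
    by move=> a b /eqP; rewrite eqn_pmul2l // => /eqP.
  - by rewrite filter_uniq // alive_uniq.
  - move=> x /mapP[k]; rewrite mem_filter => /andP[/andP[/andP[kJ jk] qk] kn] ->.
    rewrite mem_filter alive_mul ?andbT //; last by rewrite qle andbT; nia.
    rewrite dvdn_mulr // andbT expnS (leq_ltn_trans jk) ?omega_mul // andbT.
    by apply: leq_ltn_trans (_ : n * k < _)%N; rewrite ?leq_mul2r ?qle ?orbT // ltn_pmul2l.
  by move=> k; rewrite invr_ge0.
rewrite (exchange_big_dep (fun k => (k < n ^ J.+1) && (j < omega n k))%N) /= in A2; last first.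
  by move=> q k _ /and3P[-> ->].
(* After the exchange of sums, each product is counted once per big prime factor, hence fewer than 2
   (J + 1) times. *)
have A3 : 8^-1 * low_sum J n j <= (2 * (J + 1))%:R *
   \sum_(k <- alive n | (k < n ^ J.+1)%N && (j < omega n k)%N) k%:R^-1.
  apply: le_trans A2 _; rewrite big_distrr /= big_seq_cond [leRHS]big_seq_cond; apply: ler_sum.
  move=> k /and3P[kn kJ jk].
  have om : (omega n k < 2 * J.+1)%N by apply: omega_lt; rewrite kJ (alive_gt0 kn).
  apply: le_trans (_ : (omega n k)%:R * k%:R^-1 <= _).
    under eq_bigl do rewrite kJ jk /=.
    rewrite /omega -sum1_count natr_sum big_distrl /=.
    by under [leRHS]eq_bigr do rewrite mul1r.
  rewrite ler_wpM2r ?invr_ge0 // ler_nat; lia.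
have A4 : \sum_(k <- alive n | (k < n ^ J.+1)%N && (j < omega n k)%N) k%:R^-1 <=
   low_sum J n j.+1 + window_sum J n.
  rewrite (bigID (fun k => k < n ^ J)%N) /=; apply: lerD.
    rewrite le_eqVlt; apply/orP; left; apply/eqP; apply: eq_bigl => k.
    have : (n ^ J <= n ^ J.+1)%N by rewrite leq_pexp2l.
    lia.
  rewrite /window_sum big_mkcond [leRHS]big_mkcond; apply: ler_sum => k _.
  rewrite -leqNgt; case: ifP => [/andP[/andP[-> _] ->] //|_]; case: ifP => // _.
  by rewrite invr_ge0.
have := ler_wpM2l (ler0n R (2 * (J + 1))) A4.
have -> : (16 * (J + 1))%:R = 8 * (2 * (J + 1))%:R :> R by rewrite -natrM mulnA.
lra.
Qed.

(** At j = 2J [low_sum] is empty by [omega_lt]; [low_sum_step] then leads down to j = 0, where it is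
    the whole mass below [n ^ J]. *)
Lemma push_up J : exists2 C, 0 < C & exists N, forall n, (N <= n)%N ->
  \sum_(k <- alive n | (k < n ^ J)%N) k%:R^-1 <= C * window_sum J n.
Proof.
have [N HN] := low_sum_step J.
suff [C C0 HC] : exists2 C, 0 < C & forall n, (N <= n)%N -> low_sum J n 0 <= C * window_sum J n.
  by exists C => //; exists N => n /HC; rewrite /low_sum; under eq_bigl do rewrite andbT.
suff H i : exists2 C, 0 < C & forall n, (N <= n)%N ->
    low_sum J n (2 * J - i) <= C * window_sum J n.
  by have [C C0 HC] := H (2 * J)%N; exists C => //; rewrite subnn in HC.
elim: i => [|i [C C0 IH]].
  exists 1 => // n _; rewrite mul1r subn0 /low_sum big_seq_cond big_pred0 ?window_sum_ge0 //.
  move=> k; apply/negP => /and3P[kn kJ]; rewrite leqNgt omega_lt //.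
  by rewrite kJ (alive_gt0 kn).
exists (C + (16 * (J + 1))%:R * (C + 1)); first by rewrite ltr_pwDl // mulr_ge0 //; lra.
move=> n Nn; have w0 := window_sum_ge0 J n; have {}IH := IH n Nn.
have K0 : 0 <= (16 * (J + 1))%:R :> R by [].
have [le|gt] := leqP (2 * J) i.
  have e : (2 * J - i.+1 = 2 * J - i)%N by lia.
  rewrite e; apply: le_trans IH _; rewrite ler_wpM2r // lerDl mulr_ge0 //; lra.
have e : (2 * J - i = (2 * J - i.+1).+1)%N by lia.
rewrite e in IH.
have := HN n (2 * J - i.+1)%N Nn.
have := ler_wpM2l K0 IH.
have : 0 <= C * window_sum J n by rewrite mulr_ge0 // ltW.
move: ((16 * (J + 1))%:R : R) K0 (low_sum J n _) (low_sum J n _) (window_sum J n) w0.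
move=> K K0 a b x x0; nra.
Qed.

End PushUp.

(** * Counting *)

Section Bounds.
Variable R : realType.
Variables w t : nat.
Local Notation lnn := (lnn R).
Local Notation mu := (mu R w).
Local Notation V := (V R w).
Local Notation alive := (alive w t).
Local Notation mass := (mass R w t).
Local Notation dev := (dev R w).
Local Notation window_sum := (window_sum R w t).
Hypothesis t_gt0 : (0 < t)%N.
Hypothesis t_large : forall n, lnn n - mu n + 1 <= lnn t.

Lemma wsum_indicator s (P : pred nat) :
  wsum s (fun k => (P k)%:R) = \sum_(k <- s | P k) k%:R^-1 :> R.
Proof.
rewrite /wsum [RHS]big_mkcond; apply: eq_bigr => k _.
by case: (P k); rewrite ?mul1r ?mul0r.
Qed.

(** Above n^3 the shifted deviation is at least ln n, so [first_moment_upper] bounds that mass by a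
    constant times V n / ln n, hence by a constant. The mass below n^3 is pushed into a window of
    it. *)
Lemma mass_bounded : exists2 C, 0 < C & forall n, mass n <= C.
Proof.
have [CV CV0 HV] := V_upper R w; have [Cp Cp0 [N HN]] := push_up R w t 3.
have T0 : 0 <= lnn t + 2 by rewrite addr_ge0 ?lnn_ge0.
exists ((Cp + 1) * ((lnn t + 2) * CV) + V (N + 2)).
  by rewrite ltr_wpDl ?V_gt0 // !mulr_ge0 ?(ltW CV0) //; lra.
move=> n; have [nN|nN] := leqP n (N + 2).
  apply: le_trans (mass_le_V R w t n) _; apply: le_trans (V_le R w nN) _.
  by rewrite lerDr !mulr_ge0 ?(ltW CV0) //; lra.
have l0 : 0 < lnn n by apply: lnn_gt0; lia.
set H := wsum (alive n) (fun k => (~~ (k < n ^ 3)%N)%:R) : R.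
have H0 : 0 <= H by apply: wsum_ge0.
have hH : H <= (lnn t + 2) * CV.
  rewrite -(ler_pM2l l0) -wsumZ.
  apply: le_trans (_ : (lnn t + 2) * V n <= _); last first.
    by rewrite mulrCA ler_wpM2l // mulrC HV //; lia.
  apply: le_trans (first_moment_upper R w t_gt0 n); apply: wsum_le => k kn.
  case: ltnP => kn3; first by rewrite mulr0; apply: dev_ge.
  have n0 : (0 < n)%N by lia.
  rewrite mulr1; have := ler_lnn R kn3; have := mu_upper R w n; have := lnn_ge0 R t.
  by rewrite lnnX // /dev; lra.
have HW : window_sum 3 n <= H.
  rewrite /H wsum_indicator /window_sum big_mkcond [leRHS]big_mkcond; apply: ler_sum => k _.
  rewrite -leqNgt; case: (leqP (n ^ 3) k) => //= _; case: ifP => // _; by rewrite invr_ge0.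
have hm : mass n = \sum_(k <- alive n | (k < n ^ 3)%N) k%:R^-1 + H.
  rewrite /mass -wsum_indicator -wsumD; apply: wsum_eq => k _.
  by case: (k < _)%N; rewrite ?addr0 ?add0r.
have hp := HN n ltac:(lia).
rewrite hm; apply: le_trans (_ : (Cp + 1) * H <= _).
  have := ler_wpM2l (ltW Cp0) HW; lra.
apply: le_trans (_ : (Cp + 1) * ((lnn t + 2) * CV) <= _); last by rewrite lerDl ltW // V_gt0.
by rewrite ler_wpM2l //; lra.
Qed.

(** The first moment is at least c ln n. Above n^J one has dev + 1 <= 2 dev^2 / ((J - 2) ln n), so
    for large J the second moment leaves at most half of it there. The rest is at most (J + 1) ln n
    times the low mass, which [push_up] compares with the window. *)
Lemma window_lower : exists2 J, (4 <= J)%N & exists2 c, 0 < c &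
  exists N, forall n, (N <= n)%N -> c <= window_sum J n.
Proof.
have [CV CV0 HV] := V_upper R w; have [c c0 Hc] := V_lower R w.
have [CM CM0 HM] := mass_bounded.
have Q := second_moment_upper c0 HM Hc.
pose C5 := 2 * (2 * CM / c * CV).
have C50 : 0 < C5 by rewrite mulr_gt0 // mulr_gt0 // divr_gt0 // mulr_gt0.
(* This gives 4 C5 <= c (J - 2), which makes the part above n^J at most (c / 2) ln n. *)
pose T := Num.trunc (4 * C5 / c); pose J := (T + 7)%N.
have hT : 4 * C5 / c < T.+1%:R := truncnS_gt _.
have hJ : 4 * C5 <= c * (J%:R - 2).
  rewrite [c * _]mulrC -ler_pdivrMr // /J natrD.
  move: hT; rewrite -natr1; move: (4 * C5 / c) => y; lra.
have J7 : 7 <= J%:R :> R by rewrite ler_nat /J; lia.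
exists J; first by rewrite /J; lia.
have [Cp Cp0 [N HN]] := push_up R w t J.
have [N2 HN2] := exists_lnn_ge (2 : R).
exists (c / (2 * (J%:R + 1) * Cp)); first by rewrite divr_gt0 // !mulr_gt0 //; lra.
exists (N + N2 + 2)%N => n Nn.
have l2 := HN2 n ltac:(lia); have n0 : (0 < n)%N by lia.
have n1 : (1 < n)%N by lia.
have hV := HV n n1; have hc := Hc n n1; have hQ := Q n; have hp := HN n ltac:(lia).
have mu0 := mu_ge0 R w n; have muU := mu_upper R w n.
move: l2 hV hc hQ muU; set l := lnn n => l2 hV hc hQ muU.
have l0 : 0 < l by lra.
have J2 : 0 < (J%:R - 2) * l by rewrite mulr_gt0 //; lra.
have hQ' : wsum (alive n) (fun k => dev n k ^+ 2) <= C5 * l ^+ 2.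
  apply: le_trans hQ _.
  have K0 : 0 <= 2 * CM / c by rewrite divr_ge0 ?(ltW c0) // mulr_ge0 // ltW.
  apply: le_trans (_ : 2 * CM / c * (CV * l) * (2 * l) <= _).
    apply: ler_pM; [by rewrite mulr_ge0 // ltW // V_gt0 | lra | by rewrite ler_wpM2l | lra].
  by rewrite /C5 le_eqVlt; apply/orP; left; apply/eqP; ring.
have F := first_moment_lower t_gt0 t_large n.
have {}F := le_trans hc F.
have key : wsum (alive n) (fun k => dev n k + 1) <=
    (J%:R + 1) * l * wsum (alive n) (fun k => (k < n ^ J)%N%:R) +
    2 / ((J%:R - 2) * l) * wsum (alive n) (fun k => dev n k ^+ 2).
  rewrite -!wsumZ -wsumD; apply: wsum_le => k kn.
  have q0 : 0 <= 2 / ((J%:R - 2) * l) * dev n k ^+ 2.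
    by rewrite mulr_ge0 ?sqr_ge0 // divr_ge0 // ltW.
  have k0 := alive_gt0 kn.
  case: ltnP => kJ.
    rewrite mulr1; apply: ler_wpDr => //.
    have := ler_lnn R (ltnW kJ); rewrite lnnX // -/l /dev; lra.
  rewrite mulr0 add0r.
  have x1 : (J%:R - 2) * l <= dev n k.
    have := ler_lnn R kJ; rewrite lnnX // -/l /dev; lra.
  have x2 : 1 <= dev n k.
    apply: le_trans x1; rewrite -[leLHS]mulr1; apply: ler_pM; lra.
  apply: le_trans (_ : 2 * dev n k <= _); first lra.
  rewrite -mulrA ler_wpM2l // ler_pdivlMl // expr2 ler_wpM2r //; lra.
have q1 : 2 / ((J%:R - 2) * l) * wsum (alive n) (fun k => dev n k ^+ 2) <= c / 2 * l.
  apply: le_trans (_ : 2 / ((J%:R - 2) * l) * (C5 * l ^+ 2) <= _).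
    by rewrite ler_wpM2l // divr_ge0 // ltW.
  rewrite mulrAC ler_pdivrMr //.
  have := ler_wpM2r (sqr_ge0 l) hJ; rewrite expr2; lra.
rewrite wsum_indicator in key.
have JJ : 0 < (J%:R + 1) * l by rewrite mulr_gt0 //; lra.
have := ler_wpM2l (ltW JJ) hp => key2.
rewrite ler_pdivrMr; last by rewrite !mulr_gt0 //; lra.
rewrite -(ler_pM2l l0); lra.
Qed.

End Bounds.

(** * Practical numbers [t * k * q] up to [x] *)

Section Count.
Variable R : realType.
Variables w t : nat.
Local Notation lnn := (lnn R).
Local Notation mu := (mu R w).
Local Notation alive := (alive w t).
Hypothesis t_practical : sf_practical t.
Hypothesis t_smooth : forall p, prime p -> (w < p)%N -> ~~ (p %| t)%N.
Hypothesis t_large : forall n, lnn n - mu n + 1 <= lnn t.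

Definition sf_practicalb n := squarefreeb n && phistar_practical n.

Lemma exists_root_trunc E x : (0 < E)%N -> exists n, (t * n ^ E <= x < t * n.+1 ^ E)%N.
Proof.
move=> E0; have t0 := sf_practical_gt0 t_practical.
elim: x => [|x [n /andP[h1 h2]]].
  by exists 0%N; rewrite exp0n // muln0 exp1n muln1.
have [h|h] := leqP (t * n.+1 ^ E) x.+1; last by exists n; rewrite h leqW.
have e : x.+1 = (t * n.+1 ^ E)%N by lia.
by exists n.+1; rewrite e leqnn /= ltn_pmul2l // ltn_exp2r.
Qed.

Lemma count_good_large : exists2 c, 0 < c & exists N, forall x, (N <= x)%N ->
  c * x%:R <= lnn x * (count sf_practicalb (iota 1 x))%:R.
Proof.
have t0 := sf_practical_gt0 t_practical.
have [J J4 [c c0 [N HN]]] := window_lower t0 t_large.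
have [D D0 HD] := many_primes R.
(* The term [2 ^ (J + 3)] gives (n + 1)^(J+3) <= n^(J+4), so that x < t n^(J+4); the term [D] makes
   the primes [q] exceed [n]. *)
pose M := (N + D + w + 2 ^ (J + 3) + 2)%N.
exists (c / (2 * t%:R * D%:R)); first by rewrite divr_gt0 // !mulr_gt0 ?ltr0n.
exists (t * M ^ (J + 3))%N => x Mx.
have [n /andP[n1 n2]] := @exists_root_trunc (J + 3) x ltac:(lia).
have nM : (M <= n)%N.
  rewrite leqNgt; apply/negP => h.
  have : (t * n.+1 ^ (J + 3) <= t * M ^ (J + 3))%N.
    by rewrite leq_pmul2l // leq_exp2r //; lia.
  lia.
have n0 : (0 < n)%N by rewrite /M in nM; lia.
have n3 : (x < t * n ^ (J + 4))%N.
  apply: leq_trans n2 _; rewrite leq_pmul2l //.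
  apply: leq_trans (_ : (2 * n) ^ (J + 3) <= _)%N; first by rewrite leq_exp2r //; lia.
  rewrite expnMn (_ : (J + 4 = (J + 3).+1)%N) ?expnS ?leq_pmul2r ?expn_gt0 ?n0 //; last by lia.
  by rewrite /M in nM; lia.
pose ks := [seq k <- alive n | (n ^ J <= k < n ^ J.+1)%N].
pose Y k := (x %/ (t * k))%N.
pose qs k := [seq q <- index_iota (Y k %/ D).+1 (Y k).+1 | prime q].
have ksP k : k \in ks -> [/\ k \in alive n, (0 < k)%N, (n ^ J <= k)%N & (n * n <= Y k)%N].
  rewrite mem_filter => /andP[/andP[k1 k2] kn].
  have k0 := alive_gt0 kn; split=> //.
  rewrite leq_divRL ?muln_gt0 ?t0 //; apply: leq_trans n1.
  rewrite mulnCA leq_pmul2l // (_ : (J + 3 = (2 + J.+1))%N) ?expnD; last by lia.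
  by rewrite -mulnn leq_mul2l (ltnW k2) orbT.
(* Here q > n because Y k / D >= n^2 / D >= n. If q > t k, then t k^2 <= t k q <= x < t n^(J+4),
   against k >= n^J and J >= 4. *)
have qsP k q : k \in ks -> q \in qs k -> [/\ prime q, (n < q)%N, (q <= t * k)%N & (t * k * q <= x)%N].
  move=> /ksP[kn k0 k1 Yn]; rewrite mem_filter mem_index_iota ltnS => /and3P[qp q1 q2].
  have h : (t * k * q <= x)%N by move: q2; rewrite leq_divRL ?muln_gt0 ?t0 // mulnC.
  split=> //.
    apply: leq_ltn_trans q1; rewrite leq_divRL //; apply: leq_trans Yn.
    by rewrite leq_mul2l /M in nM *; lia.
  rewrite leqNgt; apply/negP => h2.
  have h3 : (t * (k * k) < t * n ^ (J + 4))%N.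
    apply: leq_ltn_trans n3; apply: leq_trans h.
    rewrite -mulnA leq_pmul2l // leq_pmul2l //; nia.
  rewrite ltn_pmul2l // in h3.
  have : (n ^ (J + 4) <= k * k)%N.
    apply: leq_trans (_ : n ^ J * n ^ J <= _)%N; last by rewrite leq_mul.
    by rewrite -expnD leq_pexp2l //; lia.
  lia.
have cnt : (\sum_(k <- ks) size (qs k) <= count sf_practicalb (iota 1 x))%N.
  rewrite -size_filter.
  have -> : (\sum_(k <- ks) size (qs k))%N = size [seq (t * k * q)%N | k <- ks, q <- qs k].
    by rewrite size_allpairs_dep sumnE big_map.
  apply: uniq_leq_size.
    (* A prime [q > n] divides no product alive at [n], so [t * k * q] determines [q] and then
       [k]. *)
    apply: allpairs_uniq_dep.
    - by rewrite filter_uniq // alive_uniq.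
    - by move=> k _; rewrite filter_uniq // iota_uniq.
    move=> [k q] [k' q'] /allpairsPdep[a [b [ka qa [-> ->]]]].
    move=> /allpairsPdep[a' [b' [ka' qa' [-> ->]]]] /= e.
    have [qp nq _ _] := qsP _ _ ka qa; have [qp' nq' _ _] := qsP _ _ ka' qa'.
    have [an _ _ _] := ksP _ ka; have [an' a'0 _ _] := ksP _ ka'.
    have e2 : (a * b = a' * b')%N by apply/eqP; rewrite -(eqn_pmul2l t0) !mulnA e.
    have eb : b = b'.
      apply/eqP; rewrite -dvdn_prime2 //.
      have : (b %| a' * b')%N by rewrite -e2 dvdn_mull.
      by rewrite Euclid_dvdM // (negbTE (alive_coprime an' qp nq)).
    rewrite -eb in e2 *; suff -> : a = a' by [].
    by apply/eqP; rewrite -(eqn_pmul2r (prime_gt0 qp)) e2.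
  move=> y /allpairsPdep[k [q [kk qk ->]]].
  have [qp nq qt qx] := qsP _ _ kk qk; have [kn k0 _ _] := ksP _ kk.
  rewrite mem_filter mem_iota add1n ltnS qx !muln_gt0 t0 k0 prime_gt0 // !andbT.
  apply: sf_practicalP; rewrite mulnC; apply: sf_practical_mul => //; last first.
  - exact: alive_practical kn.
  - lia.
  by rewrite Euclid_dvdM // negb_or t_smooth ?(alive_coprime kn) //; rewrite /M in nM; lia.
have x1 : (1 < x)%N.
  apply: leq_trans n1; apply: leq_trans (_ : n <= _)%N; first by rewrite /M in nM; lia.
  apply: leq_trans (leq_pmull _ t0); rewrite -{1}[n]expn1 leq_pexp2l //; lia.
have lx : 0 < lnn x by exact: lnn_gt0.
have Dr : 0 < D%:R :> R by rewrite ltr0n.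
have tr : 0 < t%:R :> R by rewrite ltr0n.
have xr : 0 < x%:R :> R by rewrite ltr0n; lia.
(* The 2 pays for the rounding in [Y k], which is at least 1. *)
have big : x%:R / (2 * t%:R) * window_sum R w t J n <=
    D%:R * lnn x * (\sum_(k <- ks) size (qs k))%N%:R.
  rewrite /window_sum -[\sum_(k <- alive n | _) _]big_filter -/ks natr_sum !big_distrr /= big_seq [leRHS]big_seq.
  apply: ler_sum => k kk; have [kn k0 kJ Yn] := ksP _ kk.
  have kr : 0 < k%:R :> R by rewrite ltr0n.
  have DY : (D <= Y k)%N by apply: leq_trans Yn; rewrite /M in nM; nia.
  have Yx : (Y k <= x)%N by exact: leq_div.
  rewrite size_filter; apply: le_trans (_ : (Y k)%:R <= _); last first.
    apply: le_trans (HD _ DY) _; rewrite ler_wpM2r // ler_wpM2l ?(ltW Dr) //.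
    exact: ler_lnn.
  have -> : x%:R / (2 * t%:R) * k%:R^-1 = x%:R / (2 * t%:R * k%:R) :> R by rewrite [in RHS]invfM mulrA.
  rewrite ler_pdivrMr ?mulr_gt0 // -!natrM ler_nat.
  have := ltn_ceil x (d := (t * k)%N); rewrite muln_gt0 t0 k0 => /(_ isT).
  rewrite -/(Y k); move: (Y k) DY => y Dy h; nia.
have {}HN := HN n ltac:(rewrite /M in nM; lia).
have h1 : x%:R / (2 * t%:R) * c <= D%:R * lnn x * (count sf_practicalb (iota 1 x))%:R.
  apply: le_trans (_ : x%:R / (2 * t%:R) * window_sum R w t J n <= _).
    by rewrite ler_wpM2l // divr_ge0 // ?mulr_ge0 // ltW.
  apply: le_trans big _; rewrite ler_wpM2l ?mulr_ge0 ?(ltW lx) //.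
  by rewrite ler_nat.
have -> : c / (2 * t%:R * D%:R) * x%:R = (x%:R / (2 * t%:R) * c) / D%:R.
  by field; rewrite !lt0r_neq0.
by rewrite ler_pdivrMr // [leRHS]mulrC mulrA.
Qed.

Lemma count_good : exists2 c, 0 < c & forall x, (1 < x)%N ->
  c * x%:R <= lnn x * (count sf_practicalb (iota 1 x))%:R.
Proof.
have [c c0 [N HN]] := count_good_large.
have l2 : 0 < lnn 2 by exact: lnn_gt0.
have N0 : 0 < N.+1%:R :> R by [].
exists (Num.min c (lnn 2 / N.+1%:R)); first by rewrite lt_min c0 divr_gt0.
move=> x x1; have [Nx|xN] := leqP N x.
  by apply: le_trans (HN x Nx); rewrite ler_wpM2r // ge_min lexx.
(* For the finitely many [x] below [N] the practical number 1 suffices. *)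
have g1 : (1 <= count sf_practicalb (iota 1 x))%N.
  rewrite -has_count; apply/hasP; exists 1%N; first by rewrite mem_iota; lia.
  exact/sf_practicalP/sf_practical1.
apply: le_trans (_ : lnn 2 * 1 <= _); last first.
  by rewrite ler_pM ?ler1n ?ler_lnn ?lnn_ge0.
apply: le_trans (_ : lnn 2 / N.+1%:R * x%:R <= _).
  by rewrite ler_wpM2r // ge_min lexx orbT.
by rewrite -mulrA ler_wpM2l ?(ltW l2) // ler_pdivrMl // mulr1 ler_nat; lia.
Qed.

End Count.

(** The value 6 = 5 + 1 offsets the constant of [mu_lower] and leaves the margin 1 of [t_large]. *)
Lemma count_good_ge (R : realType) : exists2 c : R, 0 < c & forall x, (1 < x)%N ->
  c * x%:R <= lnn R x * (count sf_practicalb (iota 1 x))%:R.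
Proof.
have [w Hw] := exists_rough_bound (6 : R).
apply: (@count_good R w (primorial w)).
- exact: sf_practical_primorial.
- by move=> p pp wp; rewrite prime_dvd_primorial // -ltnNge.
by move=> n; have := mu_lower R w n; lra.
Qed.

(** * Transfer to the standard reals and to real [X] *)

Import Rpower.
Open Scope R_scope.

Lemma count_good_INR : exists c : R, 0 < c /\ forall x : nat, (1 < x)%N ->
  c * INR x <= ln (INR x) * INR (count sf_practicalb (iota 1 x)).
Proof.
have [c c0 Hc] := count_good_ge R.
exists c; split; first exact/RltP.
by move=> x x1; apply/RleP; rewrite RlnE !RmultE !INRE; exact: Hc.
Qed.

Lemma nfloor_bounds (X : R) : 2 <= X ->
  (1 < nfloor X)%N /\ INR (nfloor X) <= X <= 2 * INR (nfloor X).
Proof.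
intros X2; destruct (base_Int_part X) as [h1 h2].
assert (h3 : Z.lt 1 (Int_part X)) by (apply lt_IZR; Lra.lra).
assert (e : INR (nfloor X) = IZR (Int_part X)).
{ unfold nfloor; rewrite INR_IZR_INZ Znat.Z2Nat.id; auto; clear - h3; Lia.lia. }
assert (h4 : 2 <= IZR (Int_part X)) by (apply IZR_le; clear - h3; Lia.lia).
split; [|rewrite e; Lra.lra].
apply/ssrnat.ltP; unfold nfloor; clear - h3; Lia.lia.
Qed.

Theorem theorem5p3 :
  exists l : R, 0 < l /\
    forall X : R, 2 <= X ->
      l * (X / ln X) <= INR (SF_phistar X) /\
      INR (SF_phistar X) <= INR (F_phistar X).
Proof.
destruct count_good_INR as [c [c0 Hc]].
(* Halving [c] pays for replacing [X] by its floor, as [X <= 2 * INR (nfloor X)]. *)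
exists (c / 2); split; [Lra.lra|]; intros X X2; split; last first.
  apply le_INR; apply/ssrnat.leP; apply: sub_count => n /andP[_]; exact.
destruct (nfloor_bounds X2) as [x1 [x2 x3]].
specialize (Hc _ x1); change (count sf_practicalb (iota 1 (nfloor X))) with (SF_phistar X) in Hc.
assert (lX : 0 < ln X) by (rewrite <- ln_1; apply ln_increasing; Lra.lra).
assert (x0 : 0 < INR (nfloor X)) by Lra.lra.
assert (lle : ln (INR (nfloor X)) <= ln X) 
  by (destruct x2 as [x2| ->]; [left; apply ln_increasing; assumption | right; reflexivity]).
assert (cn := pos_INR (SF_phistar X)).
apply (Rmult_le_reg_r (ln X)); [assumption|].
rewrite Rmult_assoc; unfold Rdiv at 2; rewrite (Rmult_assoc X) Rinv_l; [|Lra.lra].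
rewrite Rmult_1_r.
assert (h := Rmult_le_compat_r _ _ _ cn lle).
assert (h' := Rmult_le_compat_l _ _ _ (Rlt_le _ _ c0) x3).
Lra.lra.
Qed.
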